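(* Let $\mathcal G$ be a core input-output network and let $\mathcal K_1$ and $\mathcal K_2$ be two distinct homeostasis subnetworks of $\mathcal G$. Then the set of homeostasis subnetworks of $\mathcal G$ induced by $\mathcal K_1$ and the set of homeostasis subnetworks of $\mathcal G$ induced by $\mathcal K_2$ are distinct.
   Context: NETWORKS. An input-output network $\mathcal G$ is a finite directed graph with two distinct distinguished nodes, the input node $\iota$ and the output node $o$. It is core if every node is downstream from $\iota$ (there is a directed path from $\iota$ to it) and upstream from $o$. INDUCTION. Each node $j$ carries a variable $x_j\in\mathbb R$. An admissible system is $\dot X=f(X,\mathcal I)$ with $f$ smooth, where the real parameter $\mathcal I$ appears only in $f_\iota$, and $f_j$ depends only on $x_j$ and on those $x_\ell$ with an arrow $\ell\to j$. Write $f_{j,\ell}=\partial f_j/\partial x_\ell$; for $j\ne\ell$, $f_{j,\ell}\equiv 0$ precisely when there is no arrow $\ell\to j$. If $X_0$ is a hyperbolic equilibrium at $\mathcal I_0$, there is a unique family of equilibria $X(\mathcal I)$ near $\mathcal I_0$ with $X(\mathcal I_0)=X_0$; a node $\kappa$ is homeostatic at $(X_0,\mathcal I_0)$ if $x_\kappa'(\mathcal I_0)=0$. The homeostasis matrix $H$ is the Jacobian $J=(f_{j,\ell})$ with the row of $\iota$ and the column of $o$ deleted. There are permutation matrices $P,Q$ such that $PHQ$ is block upper triangular with square diagonal blocks $B_1,\dots,B_m$ that cannot be further block triangularized (entries $f_{j,\ell}$ regarded as independent indeterminates); these are the homeostasis blocks. The homeostasis subnetwork $\mathcal K_\eta$ of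 $B_\eta$ has as nodes all $p,q$ such that $f_{p,q}$ is a nonzero entry of $B_\eta$, and as arrows the corresponding $q\to p$ with $p\ne q$. $\mathcal K_\eta$ is homeostasis inducing at $(X_0,\mathcal I_0)$ if $\det B_\eta=0$ there. $\mathcal K\Rightarrow\kappa$ ($\mathcal K$ induces node $\kappa$) means: generically for admissible $f$, $\kappa$ is homeostatic whenever $\mathcal K$ is homeostasis inducing. Here ''generically'' means: except when the partial derivatives at $(X_0,\mathcal I_0)$ satisfy an additional polynomial equation not vanishing identically on the set where the determinant of the block of $\mathcal K$ is zero. A homeostasis subnetwork $\mathcal K$ induces a subnetwork $\mathcal K'$ (written $\mathcal K\Rightarrow\mathcal K'$) if $\mathcal K\Rightarrow\kappa$ for every node $\kappa\in\mathcal K'$. *)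

(* Defs.v *)
From HB Require Import structures.
From mathcomp Require Import all_boot all_order all_fingroup all_algebra complex.
From mathcomp Require Import all_classical all_reals all_analysis.
(* only the canonical structures of mpoly are imported: its notations clash with those of analysis. *)
From mathcomp Require mpoly.
Import (canonicals) mpoly.

Set Implicit Arguments.
Unset Strict Implicit.
Unset Printing Implicit Defensive.

Import Order.TTheory GRing.Theory Num.Theory.
Import numFieldNormedType.Exports.

Local Open Scope classical_set_scope.
Local Open Scope ring_scope.

(* [arrow l j] is the arrow l -> j. Self-loops play no role: every node is
   self-coupled in the admissible systems. *)
Record io_network (n : nat) := IONetwork {
  arrow : rel 'I_n;
  inode : 'I_n;
  onode : 'I_n;
  inode_neq_onode : inode != onode }.

Definition core n (G : io_network n) : Prop :=
  forall j, connect (arrow G) (inode G) j /\ connect (arrow G) j (onode G).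

Definition coupled n (G : io_network n) (l j : 'I_n) : bool :=
  (l == j) || arrow G l j.

Section AdmissibleSystems.
Variables (R : realType) (n : nat).

Local Notation state := ('rV[R]_n * R)%type.

Definition partial_x (f : state -> 'rV[R]_n) (j l : 'I_n) (z : state) : R :=
  'D_(delta_mx 0 l, 0) (fun z => f z 0 j) z.

Definition partial_par (f : state -> 'rV[R]_n) (j : 'I_n) (z : state) : R :=
  'D_(0, 1) (fun z => f z 0 j) z.

Definition state_jacobian (f : state -> 'rV[R]_n) (z : state) : 'M[R]_n :=
  \matrix_(j, l) partial_x f j l z.

(* All first partial derivatives of f at z: columns l < n are the derivatives
   in x_l, the last column is the derivative in the parameter. *)
Definition partials (f : state -> 'rV[R]_n) (z : state) : 'M[R]_(n, n + 1) :=
  row_mx (state_jacobian f z) (\col_j partial_par f j z).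

(* C^k for scalar functions of finitely many real variables; for k = 1 this
   is differentiability with continuous directional derivatives. *)
Fixpoint Ck (k : nat) (g : state -> R) : Prop :=
  if k is k'.+1
  then (forall z, differentiable g z) /\ (forall v, Ck k' (fun z => 'D_v g z))
  else continuous g.

Definition smooth (f : state -> 'rV[R]_n) : Prop :=
  forall j k, Ck k (fun z => f z 0 j).

Definition admissible (G : io_network n) (f : state -> 'rV[R]_n) : Prop :=
  [/\ smooth f,
      forall j (x y : 'rV[R]_n) (I : R),
        (forall l, coupled G l j -> x 0 l = y 0 l) ->
        f (x, I) 0 j = f (y, I) 0 j,
      forall j x (I I' : R), j != inode G -> f (x, I) 0 j = f (x, I') 0 j
    & forall j l, j != l ->
        (forall z, partial_x f j l z = 0) <-> ~~ arrow G l j].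

Definition hyperbolic_equilibrium (f : state -> 'rV[R]_n)
    (X0 : 'rV[R]_n) (I0 : R) : Prop :=
  f (X0, I0) = 0 /\
  forall z : R[i],
    eigenvalue (map_mx (real_complex R) (state_jacobian f (X0, I0))) z ->
    complex.Re z != 0.

Definition equilibrium_family (f : state -> 'rV[R]_n)
    (X0 : 'rV[R]_n) (I0 : R) (X : R -> 'rV[R]_n) : Prop :=
  [/\ X I0 = X0, derivable X I0 1 & \forall I \near I0, f (X I, I) = 0].

(* At a hyperbolic equilibrium the implicit function theorem provides exactly
   one germ of equilibrium family, so the quantifier denotes "the" family. *)
Definition homeostatic (f : state -> 'rV[R]_n) (X0 : 'rV[R]_n) (I0 : R)
    (kappa : 'I_n) : Prop :=
  forall X, equilibrium_family f X0 I0 X -> derive1 (fun I => X I 0 kappa) I0 = 0.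

End AdmissibleSystems.

Section BlockTriangular.
Variable S : nzRingType.

Definition block_upper_triangular m (p : 'I_m -> nat)
    (A : 'M[S]_(\sum_i p i)) : Prop :=
  forall i j : 'I_m, (j < i)%N -> submxblock A i j = 0.

(* P A Q, with P and Q permutation matrices, cut into blocks of sizes p. *)
Definition permuted_blocks k (A : 'M[S]_k) m (p : 'I_m -> nat)
    (sum_p : (\sum_i p i)%N = k) (s t : 'S_k) : 'M[S]_(\sum_i p i) :=
  castmx (esym sum_p, esym sum_p) (perm_mx s *m A *m perm_mx t).

Definition block_triangularizable k (A : 'M[S]_k) : Prop :=
  exists (m : nat) (p : 'I_m -> nat) (sum_p : (\sum_i p i)%N = k) (s t : 'S_k),
    [/\ (1 < m)%N, forall i, (0 < p i)%N
      & block_upper_triangular (permuted_blocks A sum_p s t)].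

End BlockTriangular.

Section HomeostasisBlocks.
Variables (R : realType) (n : nat) (G : io_network n).

(* Polynomials in indeterminates standing for the entries of [partials]. *)
Local Notation partials_poly := (mpoly.mpoly (n * (n + 1)) R).

Definition indet (j l : 'I_n) : partials_poly :=
  mpoly.mpolyX R (mpoly.mnm1 (mxvec_index j (lshift 1 l))).

Definition eval_partials (D : 'M[R]_(n, n + 1)) (q : partials_poly) : R :=
  mpoly.meval (fun i => mxvec D 0 i) q.

Definition generic_jacobian : 'M[partials_poly]_n :=
  \matrix_(j, l) if coupled G l j then indet j l else 0.

Definition homeostasis_matrix : 'M[partials_poly]_n.-1 :=
  row' (inode G) (col' (onode G) generic_jacobian).

(* A choice of P, Q and of diagonal blocks; the blocks do not depend on it, up
   to the order of the blocks and of the rows and columns in each of them. *)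
Record homeostasis_normal_form := HomeostasisNormalForm {
  nblocks : nat;
  block_size : 'I_nblocks -> nat;
  sum_block_size : (\sum_i block_size i)%N = n.-1;
  row_order : 'S_n.-1;
  col_order : 'S_n.-1;
  PHQ := permuted_blocks homeostasis_matrix sum_block_size row_order col_order;
  block_size_gt0 : forall eta, (0 < block_size eta)%N;
  PHQ_triangular : block_upper_triangular PHQ;
  PHQ_finest : forall eta, ~ block_triangularizable (submxblock PHQ eta eta) }.

Record subnetwork := Subnetwork {
  sub_nodes : {set 'I_n};
  sub_arrows : {set 'I_n * 'I_n} }.

Variable T : homeostasis_normal_form.
Implicit Types (eta : 'I_(nblocks T)) (D : 'M[R]_(n, n + 1)).

Definition homeostasis_block eta : 'M[partials_poly]_(block_size eta) :=
  submxblock (PHQ T) eta eta.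

Definition block_entry eta (p q : 'I_n) : bool :=
  [exists a, exists b, homeostasis_block eta a b == indet p q].

Definition homeostasis_subnetwork eta : subnetwork :=
  Subnetwork
    [set p | [exists q, block_entry eta p q || block_entry eta q p]]
    [set e | (e.1 != e.2) && block_entry eta e.2 e.1].

Definition homeostasis_inducing eta D : Prop :=
  eval_partials D (\det (homeostasis_block eta)) = 0.

(* The values that [partials f z] may take for an admissible f. *)
Definition admissible_partials D : Prop :=
  (forall j l, ~~ coupled G l j -> D j (lshift 1 l) = 0) /\
  (forall j, j != inode G -> D j (rshift n ord0) = 0).

Definition induces_node eta (kappa : 'I_n) : Prop :=
  exists q : partials_poly,
    (exists D, [/\ admissible_partials D, homeostasis_inducing eta D
                 & eval_partials D q != 0]) /\
    (forall f (X0 : 'rV[R]_n) (I0 : R),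
       admissible G f -> hyperbolic_equilibrium f X0 I0 ->
       homeostasis_inducing eta (partials f (X0, I0)) ->
       eval_partials (partials f (X0, I0)) q != 0 ->
       homeostatic f X0 I0 kappa).

Definition induces eta eta' : Prop :=
  forall kappa, kappa \in sub_nodes (homeostasis_subnetwork eta') ->
    induces_node eta kappa.

Definition induced_subnetworks eta : set subnetwork :=
  [set K | exists2 eta', K = homeostasis_subnetwork eta' & induces eta eta'].

End HomeostasisBlocks.

(* Main.v *)
Require Import Defs.
From mathcomp Require Import all_boot all_order all_fingroup all_algebra.
From mathcomp Require Import all_classical all_reals all_analysis.
From HB Require Import structures.
From mathcomp Require Import complex polyrcf ring lra.
From mathcomp Require mpoly.
Import (canonicals, coercions) mpoly.

(** In a core network there is a permutation psi of the nodes that sends the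
    output node o to the input node and every other node q to a node coupled
    to q: shift along a simple path from input to output and fix the other
    nodes ([path_permutation]). Pairing column q of the Jacobian with row
    psi q turns the homeostasis matrix into a matrix indexed by the nodes
    other than o, with a generically nonzero diagonal. Say that j depends on
    l when row psi j may be nonzero in column l. The columns of a homeostasis
    block are then a strongly connected component of this relation off o:
    otherwise the block could be triangularized further ([component_block]).
    Paths can only increase the index of the block ([connect_block_le]).

    At an equilibrium where det B_eta = 0, the derivative of the family of
    equilibria spans the kernel of the Jacobian deprived of its input row. For
    generic values of the other partial derivatives this kernel vector vanishes
    exactly at o and at the nodes with no path to the columns of B_eta. So
    - eta induces eta' as soon as no path leads from the columns of eta' to
      those of eta ([not_reaching_induced]; a row node of eta' causes no
      trouble, since if p = psi d is not o then d depends on p);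
    - eta never induces itself ([not_self_induced]).
    If eta1 and eta2 induce the same subnetworks, neither induces the other,
    so paths lead from each to the other and the two block indices are equal.

    The second point is the harder one: for every polynomial q that does not
    vanish identically on the hypersurface det B_eta = 0 it needs an actual
    admissible system, hyperbolic, with det B_eta = 0, q <> 0 and a nonzero
    derivative. This amounts to an irreducibility property of the hypersurface,
    obtained without factoring polynomials. A given point with q <> 0 is moved
    along lines until its kernel vector u has full support ([grow_kernel]).
    Matrices with such a kernel vector are products C * diag(w) with w = 1 / u
    and with rows of C summing to zero, so any two of them are joined by a
    polynomial curve, along which two polynomials that are nonzero somewhere
    are simultaneously nonzero ([generic_nonsingular]). A nonsingular Jacobian
    becomes hyperbolic after a scaling of its rows ([hyperbolic_scaling]),
    which preserves kernels. Finally a quadratic system with these first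
    derivatives and a straight line of equilibria is written down
    ([realization]). *)

Set Implicit Arguments.
Unset Strict Implicit.
Unset Printing Implicit Defensive.
Import Order.TTheory GRing.Theory Num.Theory.
Import numFieldNormedType.Exports.
Local Open Scope ring_scope.

(** * Polynomial functions of a matrix *)

Section PolynomialFunctions.
Variable R : numFieldType.

Lemma poly_nonroot (r : {poly R}) : r != 0 -> exists t, r.[t] != 0.
Proof.
move=> r0; pose rs := [seq k%:R : R | k <- iota 0 (size r)].
have urs : uniq rs by rewrite map_inj_uniq ?iota_uniq// => i j /eqP; rewrite eqr_nat => /eqP.
have [/(max_poly_roots r0)/(_ urs)|] := boolP (all (root r) rs).
  by rewrite size_map size_iota ltnn.
by case/allPn => t _; exists t.
Qed.

(** Restriction to polynomial curves reduces the genericity arguments to the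
    finiteness of the roots of a polynomial in one variable. *)
Definition polynomial_fun m n (Q : 'M[R]_(m, n) -> R) : Prop :=
  forall P : 'I_m -> 'I_n -> {poly R},
  exists r : {poly R}, forall t, r.[t] = Q (\matrix_(i, j) (P i j).[t]).

Lemma polynomial_fun_det n : polynomial_fun (@determinant R n).
Proof.
move=> P; exists (\det (\matrix_(i, j) P i j)) => t.
rewrite -[LHS]/(horner_eval t _) -det_map_mx; congr (\det _).
by apply/matrixP => i j; rewrite !mxE.
Qed.

Lemma polynomial_fun_line m n (Q : 'M[R]_(m, n) -> R) A B :
  polynomial_fun Q -> exists r : {poly R}, forall t, r.[t] = Q (A + t *: B).
Proof.
move=> /(_ (fun i j => (A i j)%:P + 'X * (B i j)%:P)) [r rP]; exists r => t.
by rewrite rP; congr Q; apply/matrixP => i j; rewrite !mxE !hornerE.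
Qed.

Lemma det0_kernel n (A : 'M[R]_n) :
  \det A = 0 <-> exists v : 'I_n -> R,
    (exists i, v i != 0) /\ forall i, \sum_j A i j * v j = 0.
Proof.
split.
  rewrite -det_tr => /eqP/det0P[v v0 vA]; exists (v 0); split.
    by apply/rV0Pn.
  move=> i; have /rowP/(_ i) := vA; rewrite [RHS]mxE => vAi.
  by rewrite -[RHS]vAi mxE; apply: eq_bigr => j _; rewrite mxE mulrC.
move=> [v [[i vi] Av]]; rewrite -det_tr; apply/eqP/det0P; exists (\row_j v j).
  by apply/rV0Pn; exists i; rewrite mxE.
apply/rowP => k; rewrite !mxE -[RHS](Av k).
by apply: eq_bigr => j _; rewrite !mxE mulrC.
Qed.

End PolynomialFunctions.

(** * Paths in a finite relation *)

(** [s] is a step along a shortest path to [y]; a function that is constant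
    along the steps of [s] is then constant, by induction on the distance. *)
Lemma parent_function (T : finType) (e : rel T) (y : T) :
  exists s : T -> T,
    (forall x, x != y -> connect e x y -> e x (s x) /\ connect e (s x) y) /\
    (forall (S : Type) (A : pred T) (f : T -> S),
       (forall x, x != y -> connect e x y -> A x -> A (s x) /\ f x = f (s x)) ->
       forall x, connect e x y -> A x -> f x = f y).
Proof.
pose reach x k := [exists p : k.-tuple T, path e x p && (last x p == y)].
have reachP x : connect e x y -> exists k, reach x k.
  move=> /connectP[p ep yp]; exists (size p); apply/existsP; exists (in_tuple p).
  by rewrite ep /= -yp.
pose d x := if pselect (exists k, reach x k) is left H then ex_minn H else 0%N.
have d_min x k : reach x k -> (d x <= k)%N.
  rewrite /d; case: pselect => [H|nH] rk; last by case: nH; exists k.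
  by case: ex_minnP => m _; apply.
have d_step x : x != y -> connect e x y ->
    exists2 x', e x x' & connect e x' y && (d x' < d x)%N.
  move=> xy cxy; have := reachP x cxy => H.
  have : reach x (d x) by rewrite /d; case: pselect => // H'; case: ex_minnP.
  case/existsP => -[[|x' p] sz] /=; first by rewrite (negbTE xy).
  move=> /andP[/andP[exx' px'] /eqP lp]; exists x' => //.
  apply/andP; split; first by apply/connectP; exists p.
  have {}sz : size p = (d x).-1 by rewrite -(eqP sz).
  have : (d x' <= size p)%N.
    apply: d_min; apply/existsP; exists (in_tuple p).
    by rewrite px' lp eqxx.
  rewrite sz => /leq_ltn_trans; apply.
  rewrite ltn_predL lt0n; apply/eqP => d0.
  have : reach x (d x) by rewrite /d; case: pselect => // H'; case: ex_minnP.
  rewrite d0 => /existsP[q]; rewrite tuple0 /= => xy'.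
  by rewrite xy' in xy.
pose s x := odflt x [pick x' | e x x' && (connect e x' y && (d x' < d x)%N)].
have sP x : x != y -> connect e x y ->
    e x (s x) && (connect e (s x) y && (d (s x) < d x)%N).
  move=> xy cxy; rewrite /s; case: pickP => [x' //|].
  by have [x' ex' cx'] := d_step x xy cxy; move/(_ x'); rewrite ex' cx'.
exists s; split=> [x xy /(sP _ xy)/and3P[]//|S A f fP x].
have [k dx] := ubnP (d x); elim: k x dx => // k IH x dx cxy Ax.
have [-> //|xy] := eqVneq x y.
have /and3P[es cs ds] := sP x xy cxy.
have [As ->] := fP x xy cxy Ax.
by apply: IH cs As; apply: leq_trans ds _.
Qed.

Lemma connect_exit (T : finType) (e : rel T) (A : {set T}) x y :
  connect e x y -> x \in A -> y \notin A ->
  exists a b, [/\ a \in A, b \notin A, e a b, connect e x a & connect e b y].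
Proof.
move=> /connectP[p]; elim: p x => [|a p IH] x /= => [_ -> ->//|].
move=> /andP[xa pa] ly xA yA; have [aA|aA] := boolP (a \in A).
  have [b [c [bA cA bc ab cy]]] := IH a pa ly aA yA.
  by exists b, c; split=> //; apply: connect_trans ab; apply: connect1.
by exists x, a; split=> //; apply/connectP; exists p.
Qed.

(** * Kernels of matrices supported on a relation *)

Section Perturbation.
Variables (R : numFieldType) (n : nat) (h : rel 'I_n) (o e : 'I_n).
Hypotheses (h_refl : forall j, j != o -> h j j) (e_neq_o : e != o).

(** The output is isolated because its column is not in the homeostasis matrix
    and the row paired with it, the input row, is not there either. *)
Definition off_output : rel 'I_n := [rel j l | [&& j != o, l != o & h j l]].

Definition reaching : {set 'I_n} := [set j | connect off_output j e].

Definition component : {set 'I_n} :=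
  [set j | connect off_output e j && connect off_output j e].

Definition supported_on (M : 'M[R]_n) : Prop :=
  forall j l, ~~ h j l -> M j l = 0.

Definition annihilates (M : 'M[R]_n) (u : 'I_n -> R) : Prop :=
  forall j, j != o -> \sum_l M j l * u l = 0.

Lemma output_not_reaching : o \notin reaching.
Proof.
rewrite inE; apply/negP => /connectP[[|x p] /=].
  by move=> _ eo; move: e_neq_o; rewrite eo eqxx.
by move=> /andP[/and3P[]]; rewrite eqxx.
Qed.

Lemma reaching_neq_output j : j \in reaching -> j != o.
Proof. by apply: contraTneq => ->; exact: output_not_reaching. Qed.

Lemma target_reaching : e \in reaching. Proof. by rewrite inE. Qed.

Lemma reaching_step j l : j != o -> l \in reaching -> h j l -> j \in reaching.
Proof.
move=> jo lU hjl; have lo := reaching_neq_output lU.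
move: lU; rewrite !inE; apply: connect_trans; apply: connect1.
by apply/and3P.
Qed.

Lemma component_reaching j : j \in component -> j \in reaching.
Proof. by rewrite !inE => /andP[]. Qed.

Lemma component_step j l :
  j \in component -> l \in reaching -> h j l -> l \in component.
Proof.
move=> jE lU hjl.
have jo := reaching_neq_output (component_reaching jE).
have lo := reaching_neq_output lU.
move: lU jE; rewrite !inE => -> /andP[ej _]; rewrite andbT.
by apply: connect_trans ej _; apply: connect1; apply/and3P.
Qed.

Lemma zero_outside_reaching (M : 'M[R]_n) u j :
  supported_on M -> (forall l, l \notin reaching -> u l = 0) ->
  j != o -> j \notin reaching -> \sum_l M j l * u l = 0.
Proof.
move=> sM u0 jo jU; apply: big1 => l _.
have [lU|/u0->] := boolP (l \in reaching); last by rewrite mulr0.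
rewrite sM ?mul0r//; apply: contra jU; exact: reaching_step.
Qed.

(** The block of [M] on [X], completed to a full-size matrix so that minors on
    arbitrary index sets are determinants of matrices of a single type. *)
Definition masked (A : nzRingType) (X : {set 'I_n}) (c : A) (M : 'M[A]_n) : 'M[A]_n :=
  \matrix_(j, l) if (j \in X) && (l \in X) then M j l else c *+ (j == l).

(** Rows of the component only see, among the reaching nodes, the component
    itself, and rows other than o that do not reach it see no reaching node at all. What
    remains is to solve for the reaching nodes outside the component, where the
    nonsingular [masked] block applies. *)
Lemma kernel_extension (M : 'M[R]_n) (c : R) (z : 'I_n -> R) :
  supported_on M -> c != 0 -> \det (masked (reaching :\: component) c M) != 0 ->
  (forall j, j \notin component -> z j = 0) ->
  (forall j, j \in component -> \sum_l M j l * z l = 0) ->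
  exists w, [/\ annihilates M w, (forall j, j \notin reaching -> w j = 0)
              & forall j, j \in component -> w j = z j].
Proof.
move=> sM c0; set X := reaching :\: component; set K := masked X c M => dK zE Mz.
pose y : 'cV[R]_n := \col_j if j \in X then - \sum_l M j l * z l else 0.
have [x Kx] : exists x, K *m x = y.
  by exists (invmx K *m y); rewrite mulKVmx// unitmxE unitfE.
have xX j : j \notin X -> x j 0 = 0.
  move=> jX; have /colP/(_ j) := Kx; rewrite !mxE (negbTE jX).
  rewrite (bigD1 j)//= big1 => [|l lj]; rewrite mxE (negbTE jX) /=.
    by rewrite eqxx mulr1n addr0 => /eqP; rewrite mulf_eq0 (negbTE c0) => /eqP.
  by rewrite eq_sym (negbTE lj) mulr0n mul0r.
have XE j : j \in component -> j \notin X by move=> jE; rewrite inE jE.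
exists (fun j => z j + x j 0); split=> [j jo|j jU|j jE].
- have -> : \sum_l M j l * (z l + x l 0) =
      \sum_l M j l * z l + \sum_l M j l * x l 0.
    by rewrite -big_split; apply: eq_bigr => l _; rewrite mulrDr.
  have [jE|jE] := boolP (j \in component).
    rewrite Mz// add0r big1// => l _.
    have [lX|/xX->] := boolP (l \in X); last by rewrite mulr0.
    move: lX; rewrite inE => /andP[lE lU]; rewrite sM ?mul0r//.
    by apply: contra lE; exact: component_step.
  have [jU|jU] := boolP (j \in reaching).
    have jX : j \in X by rewrite inE jE.
    have /colP/(_ j) := Kx; rewrite !mxE jX => Kxj.
    have -> : \sum_l M j l * x l 0 = \sum_l K j l * x l 0.
      apply: eq_bigr => l _; have [lX|lX] := boolP (l \in X).
        by rewrite mxE jX lX.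
      by rewrite xX// !mulr0.
    by rewrite Kxj subrr.
  have z0 l : l \notin reaching -> z l = 0.
    by move=> lU; apply: zE; apply: contra lU; exact: component_reaching.
  have x0 l : l \notin reaching -> x l 0 = 0.
    by move=> lU; apply: xX; rewrite inE (negbTE lU) andbF.
  by rewrite !(zero_outside_reaching sM)// addr0.
- rewrite zE ?xX ?addr0//; first by rewrite inE (negbTE jU) andbF.
  by apply: contra jU; exact: component_reaching.
by rewrite xX ?XE// addr0.
Qed.

Lemma component_kernel (M : 'M[R]_n) (u : 'I_n -> R) :
  supported_on M -> annihilates M u -> (forall j, j \notin reaching -> u j = 0) ->
  forall j, j \in component ->
    \sum_l M j l * (if l \in component then u l else 0) = 0.
Proof.
move=> sM Mu uU j jE; rewrite -[RHS](Mu j); last exact/reaching_neq_output/component_reaching.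
apply: eq_bigr => l _; case: ifPn => // lE; rewrite mulr0.
have [lU|/uU->] := boolP (l \in reaching); last by rewrite mulr0.
by rewrite sM ?mul0r//; apply: contra lE; exact: component_step.
Qed.

(** Both vectors are sent by the nonsingular [M] to the line of the output
    row. *)
Lemma annihilated_line (M : 'M[R]_n) (w u : 'I_n -> R) :
  \det M != 0 -> annihilates M w -> (exists j, w j != 0) -> annihilates M u ->
  exists c, forall j, u j = c * w j.
Proof.
move=> dM Mw w0 Mu.
have ker v : (forall j, \sum_l M j l * v l = 0) -> forall i, v i = 0.
  move=> Mv i; apply: contraNeq dM => vi; apply/eqP/det0_kernel.
  by exists v; split=> //; exists i.
pose a := \sum_l M o l * w l; pose b := \sum_l M o l * u l.
have a0 : a != 0.
  have [i wi] := w0; apply: contraNneq wi => a0; apply/eqP/ker => j.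
  by have [->//|/Mw] := eqVneq j o.
exists (b / a) => j; apply: (mulfI a0); rewrite mulrA [a * (b / a)]mulrC divfK//.
apply/eqP; rewrite -subr_eq0; apply/eqP; move: j.
apply: (ker (fun j => a * u j - b * w j)) => i.
have -> : \sum_l M i l * (a * u l - b * w l) =
    a * \sum_l M i l * u l - b * \sum_l M i l * w l.
  by rewrite !mulr_sumr -sumrB; apply: eq_bigr => l _; ring.
have [->|io] := eqVneq i o; first by rewrite -/a -/b mulrC subrr.
by rewrite Mw// Mu// !mulr0 subrr.
Qed.

Variable Q : 'M[R]_n -> R.
Hypothesis polyQ : polynomial_fun Q.

(** The solvability hypothesis of [kernel_extension] can be achieved by adding
    [t] to the diagonal entries of the reaching nodes outside the component:
    the minor becomes the value at [t] of a characteristic polynomial. *)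
Lemma generic_kernel_extension (M : 'M[R]_n) (z : 'I_n -> R) :
  supported_on M -> Q M != 0 ->
  (forall j, j \notin component -> z j = 0) -> (exists j, z j != 0) ->
  (forall j, j \in component -> \sum_l M j l * z l = 0) ->
  exists M' w, [/\ supported_on M', Q M' != 0, annihilates M' w,
     (forall j, j \notin reaching -> w j = 0)
     & exists2 j, j \in component & w j != 0].
Proof.
move=> sM QM zE [j0 zj0] Mz; set X := reaching :\: component.
pose B : 'M[R]_n := \matrix_(j, l) ((j == l) && (j \in X))%:R.
have [r rP] := polynomial_fun_line M B polyQ.
(* With value t off X, the masked matrix of M + t B is t - K0. *)
pose K0 := - masked X 0 M.
pose r' := char_poly K0.
have r'P t : r'.[t] = \det (masked X t (M + t *: B)).
  rewrite -[LHS]/(horner_eval t _) -det_map_mx; congr (\det _).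
  apply/matrixP => j l; rewrite !mxE /= /horner_eval !hornerE.
  case: ifP => [/andP[jX lX]|_]; last by case: eqP; rewrite !hornerE ?mul0rn ?oppr0 ?addr0 ?subr0.
  by rewrite jX andbT; case: eqP => _; rewrite !hornerE ?mulr1n ?mulr0n/= ?mulr1 ?mulr0 ?opprK// addrC.
have r0 : r != 0.
  by apply: contraNneq QM => r0; rewrite -[M]addr0 -(scale0r B) -rP r0 horner0.
have r'0 : r' != 0 by rewrite monic_neq0// char_poly_monic.
have [t] := poly_nonroot (mulf_neq0 (mulf_neq0 r0 r'0) (negbT (polyX_eq0 R))).
rewrite !hornerE !mulf_eq0 !negb_or => /andP[/andP[rt r't] t0].
have sM' : supported_on (M + t *: B).
  move=> j l hjl; rewrite !mxE sM// add0r; case: eqP => [jl|_] /=; last by rewrite mulr0.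
  subst l; case: (boolP (j \in X)) => [|_]; last by rewrite mulr0.
  rewrite inE => /andP[_ jU]; by rewrite h_refl ?reaching_neq_output in hjl.
have dK : \det (masked X t (M + t *: B)) != 0 by rewrite -r'P.
have [j jE|w [Mw wU wz]] := kernel_extension sM' t0 dK zE.
  rewrite -[RHS](Mz j jE); apply: eq_bigr => l _; rewrite !mxE.
  by rewrite (_ : (j \in X) = false) ?andbF ?mulr0 ?addr0// inE jE.
exists (M + t *: B), w; split=> //; first by rewrite -rP.
have jE0 : j0 \in component by apply: contraR zj0 => /zE->.
by exists j0; rewrite ?wz.
Qed.

(** Let [Z] be the reaching nodes where [w] vanishes. Since every node of [Z]
    has a path to the support of [w], some row of [Z] sees that support; the
    [blocked] rows, which do not, are thus fewer than the unknowns of [Z], and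
    there is a nonzero [z] supported on [Z] that they annihilate. In direction
    [z] every other row can be corrected through an entry in the support of
    [w], linearly in the parameter because [z] vanishes there. Iterating
    enlarges the support to all reaching nodes. *)
Lemma grow_kernel (M : 'M[R]_n) (w : 'I_n -> R) :
  supported_on M -> Q M != 0 -> annihilates M w ->
  (forall j, j \notin reaching -> w j = 0) -> (exists2 j, j \in component & w j != 0) ->
  exists M' u, [/\ supported_on M', Q M' != 0, annihilates M' u
                 & forall j, (u j != 0) = (j \in reaching)].
Proof.
move=> sM QM Mw wU wE.
have [k] := ubnP #|reaching :\: [set j | w j != 0]|.
elim: k M w sM QM Mw wU wE => // k IH M w sM QM Mw wU wE.
set Z := reaching :\: _; rewrite ltnS => leZk.
have ZP j : (j \in Z) = (w j == 0) && (j \in reaching) by rewrite !inE negbK.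
have [Z0|/set0Pn[a aZ]] := eqVneq Z finset.set0.
  exists M, w; split=> // j; apply/idP/idP => [wj|jU].
    by apply: contraR wj => /wU->.
  by have := ZP j; rewrite Z0 inE jU andbT => /esym/negbT.
pose blocked j := (j \in Z) && [forall l, (w l != 0) ==> ~~ h j l].
have [b bZ nb] : exists2 b, b \in Z & ~~ blocked b.
  have [j jE wj] := wE.
  have aj : connect off_output a j.
    move: aZ jE; rewrite ZP !inE => /andP[_ ae] /andP[ej _].
    exact: connect_trans ae ej.
  have jZ : j \notin Z by rewrite ZP (negbTE wj).
  have [b [c [bZ cZ /and3P[bo co hbc] _ cj]]] := connect_exit aj aZ jZ.
  exists b => //; rewrite /blocked bZ /= negb_forall; apply/existsP; exists c.
  rewrite negb_imply hbc andbT; apply: contra cZ => wc; rewrite ZP wc /=.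
  by move: (component_reaching jE); rewrite !inE; exact: connect_trans.
(* The rows of B outside Z force the kernel to be supported on Z; as b is not
   blocked, its row is zero and B is singular. *)
pose B : 'M[R]_n := \matrix_(j, l)
  if j \in Z then if blocked j then if l \in Z then M j l else 0 else 0
  else (j == l)%:R.
have /det0_kernel[z [[c zc] Bz]] : \det B = 0.
  rewrite (expand_det_row _ b) big1// => l _.
  by rewrite mxE bZ (negbTE nb) mul0r.
have zZ j : j \notin Z -> z j = 0.
  move=> jZ; rewrite -[RHS](Bz j) (bigD1 j)//= big1 => [|l lj]; rewrite mxE (negbTE jZ).
    by rewrite eqxx mul1r addr0.
  by rewrite eq_sym (negbTE lj) mul0r.
pose pivot j := odflt j [pick l | (w l != 0) && h j l].
have pivotP j : j \in reaching -> ~~ blocked j -> (w (pivot j) != 0) && h j (pivot j).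
  move=> jU; rewrite /blocked ZP jU andbT /pivot; case: pickP => //= nw.
  have [w0|wj] := eqVneq (w j) 0.
    by rewrite /= => /forallPn[l]; rewrite negb_imply negbK nw.
  by have := nw j; rewrite wj h_refl ?reaching_neq_output.
have Mz0 j : blocked j -> \sum_l M j l * z l = 0.
  move=> bj; rewrite -[RHS](Bz j); apply: eq_bigr => l _; rewrite mxE bj.
  have jZ : j \in Z by case/andP: bj.
  by rewrite jZ; case: ifPn => // /zZ->; rewrite !mulr0.
pose corrected j := (j \in reaching) && ~~ blocked j.
pose D : 'M[R]_n := \matrix_(j, l)
  if corrected j && (l == pivot j) then - (\sum_l' M j l' * z l') / w l else 0.
have [r rP] := polynomial_fun_line M D polyQ.
have r0 : r != 0.
  by apply: contraNneq QM => r0; rewrite -[M]addr0 -(scale0r D) -rP r0 horner0.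
have [t] := poly_nonroot (mulf_neq0 r0 (negbT (polyX_eq0 R))).
rewrite !hornerE !mulf_eq0 !negb_or => /andP[rt t0].
have wz j : w j != 0 -> z j = 0.
  by move=> wj; apply: zZ; rewrite ZP (negbTE wj).
have uU j : j \notin reaching -> w j + t * z j = 0.
  by move=> jU; rewrite wU// zZ ?mulr0 ?addr0// ZP (negbTE jU) andbF.
pose Z' := reaching :\: [set j | w j + t * z j != 0].
have ltk : (#|Z'| < k)%N.
  apply: leq_trans leZk; apply: proper_card; apply/properP; split.
    apply/fintype.subsetP => j; rewrite !inE !negbK => /andP[/eqP wj ->].
    rewrite andbT; apply/negPn/negP => wj0; move: wj.
    by rewrite wz// mulr0 addr0 => /eqP; rewrite (negbTE wj0).
  have cZ : c \in Z by apply: contraR zc => /zZ->.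
  exists c => //; rewrite !inE !negbK negb_and.
  by move: cZ; rewrite ZP => /andP[/eqP-> _]; rewrite add0r mulf_neq0.
apply: (IH (M + t *: D) (fun j => w j + t * z j)) => //.
- move=> j l hjl; rewrite !mxE sM// add0r.
  case: ifP => [|_]; last by rewrite mulr0.
  move=> /andP[/andP[jU bj] /eqP lE].
  by have /andP[_] := pivotP j jU bj; rewrite -lE (negbTE hjl).
- by rewrite -rP.
- move=> j jo; have -> : \sum_l (M + t *: D) j l * (w l + t * z l) =
      \sum_l M j l * w l + t * \sum_l M j l * z l
      + t * \sum_l D j l * (w l + t * z l).
    rewrite !mulr_sumr -!big_split; apply: eq_bigr => l _ /=.
    rewrite [(M + _) j l]mxE [(t *: D) j l]mxE; ring.
  rewrite Mw// add0r -mulrDr; have [jc|] := boolP (corrected j).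
    have /andP[jU bj] := jc; have /andP[wp hp] := pivotP j jU bj.
    rewrite [X in _ + X](bigD1 (pivot j))//= [X in _ + (_ + X)]big1 => [|l lp].
      by rewrite mxE jc eqxx wz// mulr0 !addr0 divfK// subrr mulr0.
    by rewrite mxE (negbTE lp) andbF mul0r.
  move=> jc; rewrite [X in _ + X]big1 ?addr0 => [|l _]; last first.
    by rewrite mxE (negbTE jc) mul0r.
  move: jc; rewrite negb_and negbK => /orP[jU|bj]; last by rewrite Mz0 ?mulr0.
  rewrite (zero_outside_reaching sM)// ?mulr0// => l lU.
  by apply: zZ; rewrite ZP (negbTE lU) andbF.
have [j jE wj] := wE; exists j => //.
by rewrite wz// mulr0 addr0.
Qed.

End Perturbation.

Section GenericPoint.
Variables (R : numFieldType) (n : nat) (h : rel 'I_n) (o e : 'I_n).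
Hypotheses (h_refl : forall j, j != o -> h j j) (e_neq_o : e != o).
Hypotheses (to_output : forall j, connect h j o)
           (from_output : forall j, connect h o j).

Local Notation g := (off_output h o).
Local Notation L := (reaching h o e).

Lemma output_edge : exists2 k, k \in L & h o k.
Proof.
have eC : e \notin ~: L by rewrite inE negbK target_reaching.
have oC : o \in ~: L by rewrite inE output_not_reaching.
have [a [k [aL kL hak _ _]]] := connect_exit (from_output e) oC eC.
rewrite inE negbK in kL; exists k => //.
suff <- : a = o by []; apply/eqP/negPn/negP => ao.
by move: aL; rewrite inE (reaching_step e_neq_o ao kL hak).
Qed.

Lemma exit_edge : exists r t,
  [/\ r \in L, t \notin L, h r t & forall j, j \in L -> connect g j r].
Proof.
pose A := [set j in L | connect g e j].
have eA : e \in A by rewrite inE target_reaching connect0.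
have oA : o \notin A by rewrite inE negb_and output_not_reaching.
have [r [t [rA tA hrt _ _]]] := connect_exit (to_output e) eA oA.
move: rA; rewrite inE => /andP[rL er]; exists r, t; split=> // [|j].
  apply: contra tA => tL; rewrite inE tL; apply: connect_trans er _.
  apply: connect1; apply/and3P; split=> //.
    exact: reaching_neq_output rL.
  exact: reaching_neq_output tL.
by rewrite inE => je; exact: connect_trans je er.
Qed.

(** A Laplacian of two trees: the reaching nodes lead to the node [r] of an exit
    edge [r -> t], the other nodes lead to the output. Row [j] says that a
    kernel vector takes equal values at [j] and at its parent, rows [r] and [o]
    say that it vanishes at [t] and at some reaching node [k]. *)
Lemma nonsingular_sample : exists M : 'M[R]_n,
  [/\ supported_on h M, forall j, j != o -> \sum_(l in L) M j l = 0
    & \det M != 0].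
Proof.
have [k kL hok] := output_edge.
have [r [t [rL tL hrt toR]]] := exit_edge.
have [s [gs sconst]] := parent_function g r.
have [s' [hs' s'const]] := parent_function h o.
have ro := reaching_neq_output e_neq_o rL.
have jo j : j \in L -> j != o := reaching_neq_output e_neq_o (j := j).
pose next j := if j \in L then s j else s' j.
pose M : 'M[R]_n := \matrix_(j, l)
  if j == o then (l == k)%:R else if j == r then (l == t)%:R
  else (l == j)%:R - (l == next j)%:R.
have hnext j : j != o -> j != r -> h j (next j).
  rewrite /next => jo' jr; case: ifPn => [/toR/(gs _ jr)[/and3P[]]//|_].
  by have [] := hs' j jo' (to_output j).
have nextL j : j != o -> j != r -> (next j \in L) = (j \in L).
  move=> jo' jr; apply/idP/idP => [nL|jL].
    exact: (reaching_step e_neq_o jo' nL (hnext _ jo' jr)).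
  have [_ sr] := gs j jr (toR j jL); rewrite /next jL.
  by move: rL; rewrite !inE; exact: connect_trans sr.
have sum_delta i (x : 'I_n -> R) : \sum_l (l == i)%:R * x l = x i.
  rewrite (bigD1 i)//= eqxx mul1r big1 ?addr0// => l li.
  by rewrite (negbTE li) mul0r.
have sumL_delta i : \sum_(l in L) (l == i)%:R = (i \in L)%:R :> R.
  rewrite big_mkcond -[RHS](sum_delta i (fun l => (l \in L)%:R)) /=.
  by apply: eq_bigr => l _; case: (l \in L); rewrite ?mulr1 ?mulr0.
exists M; split.
- move=> j l; rewrite mxE; case: eqP => [->|/eqP jo'].
    by case: eqP => // ->; rewrite hok.
  case: eqP => [->|/eqP jr]; first by case: eqP => // ->; rewrite hrt.
  case: eqP => [->|_]; first by rewrite h_refl.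
  by case: eqP => [->|_]; rewrite ?hnext// subrr.
- move=> j jo'; have [->|jr] := eqVneq j r.
    rewrite -[RHS]/(false%:R) -(negbTE tL) -sumL_delta.
    by apply: eq_bigr => l _; rewrite mxE (negbTE ro) eqxx.
  transitivity (\sum_(l in L) ((l == j)%:R - (l == next j)%:R) : R).
    by apply: eq_bigr => l _; rewrite mxE (negbTE jo') (negbTE jr).
  by rewrite big_split /= sumrN !sumL_delta nextL// subrr.
apply/eqP => /det0_kernel[x [[i xi] Mx]].
have xo : x k = 0.
  rewrite -[RHS](Mx o) -(sum_delta k); apply: eq_bigr => l _.
  by rewrite mxE eqxx.
have xr : x t = 0.
  rewrite -[RHS](Mx r) -(sum_delta t); apply: eq_bigr => l _.
  by rewrite mxE eqxx (negbTE ro).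
have xnext j : j != o -> j != r -> x j = x (next j).
  move=> jo' jr; apply/eqP; rewrite -subr_eq0 -[X in _ == X](Mx j).
  rewrite -(sum_delta j) -(sum_delta (next j)) -sumrB; apply/eqP.
  by apply: eq_bigr => l _; rewrite mxE (negbTE jo') (negbTE jr) mulrBl.
have xL j : j \in L -> x j = x r.
  move=> jL; apply: (sconst _ (mem L)) (toR j jL) jL => {}j jr _ jL.
  have {}jL : j \in L := jL.
  have := xnext j (jo j jL) jr; have := nextL j (jo j jL) jr.
  by rewrite /next jL => sL xj; split.
have xN j : j \notin L -> x j = x o.
  move=> jL; apply: (s'const _ [predC L]) (to_output j) jL => {}j jo' _ jL.
  have {}jL : j \notin L := jL.
  have jr : j != r by apply: contraNneq jL => ->.
  have := xnext j jo' jr; have := nextL j jo' jr.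
  by rewrite /next (negbTE jL) => sL xj; split=> //; rewrite /= sL.
have x0 : x r = 0 by rewrite -(xL k kL).
have x0' : x o = 0 by rewrite -(xN t tL).
move: xi; have [/xL->|/xN->] := boolP (i \in L); by rewrite ?x0 ?x0' eqxx.
Qed.

Variable Q : 'M[R]_n -> R.
Hypothesis polyQ : polynomial_fun Q.

(** Entries of [P] in reaching columns are those of a matrix whose rows sum to
    zero, interpolated between the two given ones, times an interpolated column
    weight [w] equal to the inverse of the kernel vector: the kernel relation
    holds all along the curve. *)
Lemma generic_nonsingular (M0 : 'M[R]_n) (u0 : 'I_n -> R) :
  supported_on h M0 -> Q M0 != 0 -> annihilates o M0 u0 ->
  (forall j, (u0 j != 0) = (j \in L)) ->
  exists M u, [/\ supported_on h M, Q M != 0, annihilates o M u,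
    (forall j, (u j != 0) = (j \in L)) & \det M != 0].
Proof.
move=> sM0 QM0 M0u0 u0L.
have [M1 [sM1 M1sum dM1]] := nonsingular_sample.
pose w l : {poly R} := (u0 l)^-1%:P * (1 - 'X) + 'X.
pose P j l : {poly R} :=
  if (j != o) && (l \in L)
  then ((M0 j l * u0 l)%:P * (1 - 'X) + (M1 j l)%:P * 'X) * w l
  else (M0 j l)%:P * (1 - 'X) + (M1 j l)%:P * 'X.
pose C t : 'M[R]_n := \matrix_(j, l) (P j l).[t].
have C0 : C 0 = M0.
  apply/matrixP => j l; rewrite mxE /P /w; case: ifPn => [/andP[_ lL]|_];
    rewrite !hornerE ?subr0 ?mulr1 ?mulr0 ?addr0//.
  by rewrite /= !mulr1 mulfK// u0L.
have C1 : C 1 = M1.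
  apply/matrixP => j l; rewrite mxE /P /w; case: ifPn => [/andP[_ lL]|_];
    by rewrite !hornerE ?subrr ?mulr1 ?mulr0 ?add0r ?mulr1.
have [r rP] := polyQ P; have [d dP] := polynomial_fun_det P.
have r0 : r != 0.
  by apply: contraNneq QM0 => r0; rewrite -C0 -rP r0 horner0.
have d0 : d != 0.
  by apply: contraNneq dM1 => d0; rewrite -C1 -dP d0 horner0.
have w0 : \prod_(l in L) w l != 0.
  apply/prodf_neq0 => l _; apply: contraTneq (oner_neq0 R) => w0.
  have := congr1 (horner^~ 1) w0; rewrite !hornerE subrr mulr0 add0r => ->.
  by rewrite eqxx.
have [t] := poly_nonroot (mulf_neq0 (mulf_neq0 r0 d0) w0).
rewrite !hornerM horner_prod !mulf_eq0 !negb_or => /andP[/andP[rt dt]].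
move=> /prodf_neq0 wt.
exists (C t), (fun l => if l \in L then (w l).[t]^-1 else 0); split.
- move=> j l hjl; rewrite mxE /P sM0// sM1// !(mul0r, addr0).
  by case: ifP => _; rewrite !hornerE.
- by rewrite -rP.
- move=> j jo; rewrite (bigID (mem L))/= [X in _ + X]big1 ?addr0; last first.
    by move=> l lL; rewrite (negbTE lL) mulr0.
  transitivity ((\sum_l M0 j l * u0 l) * (1 - t) + (\sum_(l in L) M1 j l) * t).
    have -> : \sum_l M0 j l * u0 l = \sum_(l in L) M0 j l * u0 l.
      rewrite [LHS](bigID (mem L))/= [X in _ + X]big1 ?addr0// => l.
      by rewrite -u0L negbK => /eqP->; rewrite mulr0.
    rewrite !mulr_suml -big_split; apply: eq_bigr => l lL /=.
    rewrite lL mxE /P jo lL /= hornerM mulfK ?wt//.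
    by rewrite !hornerE.
  by rewrite M0u0// M1sum// !mul0r addr0.
- move=> j; case: ifP => [jL|_]; last by rewrite eqxx.
  by rewrite invr_eq0 wt.
by rewrite -dP.
Qed.

Lemma generic_homeostasis_point (M : 'M[R]_n) (z : 'I_n -> R) :
  supported_on h M -> Q M != 0 ->
  (forall j, j \notin component h o e -> z j = 0) -> (exists j, z j != 0) ->
  (forall j, j \in component h o e -> \sum_l M j l * z l = 0) ->
  exists M' u, [/\ supported_on h M', Q M' != 0, annihilates o M' u,
    (forall j, (u j != 0) = (j \in L)) & \det M' != 0].
Proof.
move=> sM QM zE z0 Mz.
have [M1 [w [sM1 QM1 M1w wU wE]]] :=
  generic_kernel_extension h_refl e_neq_o polyQ sM QM zE z0 Mz.
have [M2 [u [sM2 QM2 M2u uL]]] := grow_kernel h_refl e_neq_o polyQ sM1 QM1 M1w wU wE.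
exact: generic_nonsingular sM2 QM2 M2u uL.
Qed.

End GenericPoint.

(** * Making a Jacobian hyperbolic by scaling its rows *)

Section Hyperbolicity.
Variable R : realType.
Implicit Types (f g p : {poly R}).

(** Even powers of an imaginary number are real and odd ones imaginary, hence
    the parities of [a] and [b]. *)
Lemma eval_imaginary f : exists a b : {poly R},
  [/\ forall w, (map_poly (real_complex R) f).[Complex 0 w] = Complex a.[w] b.[w],
      forall w, a.[- w] = a.[w] & forall w, b.[- w] = - b.[w]].
Proof.
elim/poly_ind: f => [|f c [a [b [fE aE bE]]]].
  by exists 0, 0; split=> w; rewrite ?rmorph0 !horner0 ?oppr0.
exists (c%:P - b * 'X), (a * 'X); split=> w.
- rewrite rmorphD rmorphM /= map_polyX map_polyC /= !hornerE fE.
  by apply/eqP; rewrite eq_complex /=; apply/andP; split; apply/eqP; ring.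
- by rewrite !hornerE bE mulrNN.
by rewrite !hornerE aE mulrN.
Qed.

Definition off_imaginary_axis f : Prop :=
  forall w, (map_poly (real_complex R) f).[Complex 0 w] != 0.

Lemma itv_avoid (bad : seq R) (a b : R) : a < b ->
  exists2 x, a < x < b & x \notin bad.
Proof.
move=> ab; pose pt k : R := a + (b - a) / k.+2%:R.
have pt_inj : injective pt.
  move=> i j /addrI /(mulfI _); rewrite subr_eq0 gt_eqF// => /(_ isT) /invr_inj.
  by move=> /eqP; rewrite eqr_nat => /eqP [].
have [/allP pts|] := boolP (all (mem bad) (map pt (iota 0 (size bad).+1))).
  have : uniq (map pt (iota 0 (size bad).+1)) by rewrite map_inj_uniq ?iota_uniq.
  by move=> /uniq_leq_size/(_ pts); rewrite size_map size_iota ltnn.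
case/allPn => x /mapP[k _ ->] kbad; exists (pt k) => //.
have k0 : (0 : R) < k.+2%:R by rewrite ltr0n.
rewrite /pt ltrDl divr_gt0 ?subr_gt0//= -ltrBrDl.
by rewrite ltr_pdivrMr// ltr_pMr ?subr_gt0// ltr1n.
Qed.

(** For nonzero [p], [s] is the sign of the leading coefficient; evenness makes
    the same threshold valid at both ends. *)
Lemma even_poly_one_sided p : (forall w, p.[- w] = p.[w]) ->
  exists s m : R, [/\ s ^+ 2 = 1, 0 <= m & forall w, m <= `|w| -> 0 <= s * p.[w]].
Proof.
move=> pE.
have main (q : {poly R}) : (forall w, q.[- w] = q.[w]) -> 0 < lead_coef q ->
    exists2 m, 0 <= m & forall w, m <= `|w| -> 0 <= q.[w].
  move=> qE q0; have [m qm] := poly_pinfty_gt_lc q0.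
  exists (Num.max 0 m); first by rewrite le_max lexx.
  move=> w; rewrite ge_max => /andP[_ mw].
  have -> : q.[w] = q.[`|w|].
    by case: (ger0P w) => // _; rewrite qE.
  by apply: le_trans (ltW q0) (qm _ mw).
have [->|p0] := eqVneq p 0.
  by exists 1, 0; split; rewrite ?expr1n// => w _; rewrite horner0 mulr0.
have [lp|lp|/eqP] := ltgtP 0 (lead_coef p); last by rewrite eq_sym lead_coef_eq0 (negbTE p0).
  have [m m0 mP] := main p pE lp.
  by exists 1, m; split; rewrite ?expr1n// => w /mP; rewrite mul1r.
have [||m m0 mP] := main (- p); first by move=> w; rewrite !hornerN pE.
  by rewrite lead_coefN oppr_gt0.
by exists (-1), m; split; rewrite ?sqrrN ?expr1n// => w /mP; rewrite hornerN mulN1r.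
Qed.

(** On the imaginary axis [f + c g] vanishes only where [g / f] takes the real
    value [- 1 / c]. Either [g / f] is real at finitely many points, whose values
    are to be avoided, or it is real everywhere; it is then an even function,
    hence bounded below or above, and all small [c] of one sign are suitable. *)
Lemma perturb_off_imaginary_axis f g (bad : seq R) : off_imaginary_axis f ->
  exists2 c, c \notin bad & off_imaginary_axis (f + c%:P * g).
Proof.
move=> fI; have [a [b [fE aE bE]]] := eval_imaginary f.
have [a' [b' [gE aE' bE']]] := eval_imaginary g.
pose S := a ^+ 2 + b ^+ 2; pose N := a' * a + b' * b; pose D := b' * a - a' * b.
have S_gt0 w : 0 < S.[w].
  rewrite lt_neqAle !hornerE addr_ge0 ?sqr_ge0// andbT eq_sym.
  rewrite paddr_eq0 ?sqr_ge0// !sqrf_eq0; apply: contra (fI w) => /andP[/eqP a0 /eqP b0].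
  by rewrite fE a0 b0.
have reduce c : (forall w, c != 0 -> D.[w] = 0 -> S.[w] + c * N.[w] != 0) ->
    off_imaginary_axis (f + c%:P * g).
  move=> cP w; have [->|c0] := eqVneq c 0; first by rewrite mul0r addr0.
  rewrite rmorphD rmorphM /= map_polyC /= !hornerE fE gE; apply/negP => /eqP.
  move=> [] /=; rewrite !mul0r subr0 addr0 => e1 e2.
  have DN : c * D.[w] = a.[w] * (b.[w] + c * b'.[w]) - b.[w] * (a.[w] + c * a'.[w]).
    by rewrite !hornerE; ring.
  have D0 : D.[w] = 0.
    by apply: (mulfI c0); rewrite DN e1 e2 !mulr0 subr0.
  have := cP w c0 D0; have -> : S.[w] + c * N.[w] =
      a.[w] * (a.[w] + c * a'.[w]) + b.[w] * (b.[w] + c * b'.[w]).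
    by rewrite !hornerE; ring.
  by rewrite e1 e2 !mulr0 addr0 eqxx.
have [D0|D0] := eqVneq D 0; last first.
  pose bad' := bad ++ [seq - S.[w] / N.[w] | w <- rootsR D].
  have [c _] := itv_avoid bad' (ltr01 : (0 : R) < 1).
  rewrite mem_cat negb_or => /andP[cbad cS]; exists c => //.
  apply: reduce => w c0 Dw; apply: contra cS => SN; apply/mapP; exists w.
    by rewrite -(roots_on_rootsR D0) in_itv /=; apply/eqP.
  have N0 : N.[w] != 0.
    by apply: contraTneq SN => ->; rewrite mulr0 addr0 gt_eqF.
  by apply: (mulIf N0); rewrite divfK//; apply/eqP; rewrite -addr_eq0 addrC.
have NE w : N.[- w] = N.[w].
  by rewrite !hornerE aE aE' bE bE' mulrNN.
have [s [m [s2 m0 Ninf]]] := even_poly_one_sided NE.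
have [|x _ Smin] := @EVT_min R (horner S) (- m) m (ge0_cp m0).2.
  by apply: continuous_subspaceT => y; exact: continuous_horner.
have [ub Nub] := poly_itv_bound N (- m) m.
have ub1 : 0 < `|ub| + 1 by rewrite ltr_wpDl.
have [t /andP[t0 tlt] tbad] := itv_avoid [seq s * c | c <- bad] (divr_gt0 (S_gt0 x) ub1).
exists (s * t).
  apply: contra tbad => stb; apply/mapP; exists (s * t) => //.
  by rewrite mulrA -expr2 s2 mul1r.
apply: reduce => w _ _; rewrite gt_eqF//.
have [mw|wm] := leP m `|w|.
  by rewrite ltr_pwDl ?S_gt0// mulrAC mulr_ge0// ?Ninf// ltW.
have wI : - m <= w <= m by rewrite -ler_norml ltW.
have Sx : S.[x] <= S.[w] by apply: Smin; rewrite in_itv.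
have Nw := Nub w wI.
have s1 : `|s| = 1.
  by apply/eqP; rewrite -[_ == _](@eqrXn2 _ 2) ?normr_ge0// -normrX s2 normr1 expr1n.
have stN : `|s * t * N.[w]| < S.[x].
  rewrite !normrM s1 mul1r gtr0_norm//.
  apply: le_lt_trans (_ : t * (`|ub| + 1) < _); last by rewrite -ltr_pdivlMr.
  rewrite ler_pM2l//; apply: le_trans Nw _.
  by rewrite ler_wpDr// ler_norm.
by move: stN; rewrite ltr_norml => /andP[lo _]; lra.
Qed.

(** Scaling the rows of [J] by [d] gives the spectrum of the pencil of [J] with
    [e = 1 / d]; unlike [d], the vector [e] may start from zero, where the
    determinant is the nonzero constant [det J]. *)
Definition pencil n (J : 'M[R]_n) (e : 'I_n -> R) : 'M[{poly R}]_n :=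
  \matrix_(i, j) ((J i j)%:P - 'X * ((i == j)%:R * e i)%:P).

Lemma pencil_det_affine n (J : 'M[R]_n) (e : 'I_n -> R) (k : 'I_n) : e k = 0 ->
  exists g, forall c,
    \det (pencil J (fun i => if i == k then c else e i)) = \det (pencil J e) + c%:P * g.
Proof.
move=> ek0; have lift_eqF i : (lift k i == k) = false by rewrite eq_sym (negbTE (neq_lift k i)).
exists (\det (\matrix_(i, j) if i == k then - 'X *+ (i == j)
  else pencil J e i j)) => c.
rewrite -[\det (pencil J e)]mul1r; apply: (@determinant_multilinear _ _ _ _ _ k).
- apply/rowP => j; rewrite !mxE eqxx ek0 mulr0 mulr0 subr0 mul1r.
  by case: eqP => _; rewrite ?mul1r ?mul0r ?mulr0 ?subr0 ?addr0 ?mulr1n// mulrN mulrC.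
- by apply/matrixP => i j; rewrite !mxE lift_eqF.
- by apply/matrixP => i j; rewrite !mxE lift_eqF.
Qed.

Definition scale_rows n (d : 'I_n -> R) (J : 'M[R]_n) : 'M[R]_n :=
  \matrix_(i, j) (d i * J i j).

(** The entries of [1 / d] are switched on one at a time: each step perturbs the
    determinant affinely and only excludes finitely many values for [Q]. *)
Lemma off_imaginary_pencil n (J : 'M[R]_n) (Q : 'M[R]_n -> R) :
  polynomial_fun Q -> Q J != 0 -> \det J != 0 ->
  exists d : 'I_n -> R, [/\ forall i, d i != 0, Q (scale_rows d J) != 0
    & off_imaginary_axis (\det (pencil J (fun i => (d i)^-1)))].
Proof.
move=> polyQ QJ dJ.
suff main k : (k <= n)%N -> exists d : 'I_n -> R,
    [/\ forall i, d i != 0, forall i : 'I_n, (k <= i)%N -> d i = 1, Q (scale_rows d J) != 0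
    & off_imaginary_axis (\det (pencil J (fun i => if (i < k)%N then (d i)^-1 else 0)))].
  have [d [d0 _ Qd dI]] := main n (leqnn n); exists d; split=> //.
  by move: dI; under [X in pencil _ X]funext do rewrite ltn_ord.
elim: k => [_|k IH kn].
  exists (fun=> 1); split=> [i|//||w]; rewrite ?oner_neq0//.
    by rewrite (_ : scale_rows _ J = J)//; apply/matrixP => i j; rewrite mxE mul1r.
  rewrite (_ : pencil J _ = map_mx polyC J); last first.
    by apply/matrixP => i j; rewrite !mxE ltn0 mulr0 mulr0 subr0.
  by rewrite det_map_mx map_polyC hornerC /= fmorph_eq0.
have [d [d0 d1 Qd dI]] := IH (ltnW kn).
pose K := Ordinal kn.
pose e (i : 'I_n) := if (i < k)%N then (d i)^-1 else 0.
have [g gP] := @pencil_det_affine n J e K (ltac:(by rewrite /e ltnn)).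
have [r rP] := polyQ (fun i j => (if i == K then 'X else (d i)%:P) * (J i j)%:P).
have r1 : r != 0.
  apply: contraNneq Qd => r0; have := rP 1; rewrite r0 horner0 => /esym Q0.
  rewrite -[X in _ == X]Q0; apply/eqP; congr Q; apply/matrixP => i j; rewrite !mxE !hornerE.
  by case: eqP => [->|_]; rewrite ?hornerX ?hornerC// d1.
have [c cbad cI] := perturb_off_imaginary_axis g (0 :: [seq x^-1 | x <- rootsR r]) dI.
move: cbad; rewrite inE negb_or => /andP[c0 cr].
exists (fun i => if i == K then c^-1 else d i); split.
- by move=> i; case: ifP => _; [rewrite invr_eq0|exact: d0].
- move=> i ki; rewrite ifN ?d1 ?(ltnW ki)//.
  by apply: contraTneq ki => ->; rewrite /= ltnn.
- have <- : r.[c^-1] = Q (scale_rows (fun i => if i == K then c^-1 else d i) J).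
    rewrite rP; congr Q; apply/matrixP => i j; rewrite !mxE.
    by case: eqP; rewrite !hornerE.
  apply: contra cr => rc; apply/mapP; exists c^-1; rewrite ?invrK//.
  by rewrite -(roots_on_rootsR r1) in_itv.
move: cI; rewrite -gP; congr (off_imaginary_axis (\det (pencil J _))).
apply/funext => i; case: (eqVneq i K) => [->|iK]; first by rewrite /= ltnSn invrK.
have ik : ((i : nat) == k) = false by apply/negbTE; rewrite -val_eqE in iK.
by rewrite /e ltnS [(i <= k)%N]leq_eqVlt ik.
Qed.

Lemma hyperbolic_scaling n (J : 'M[R]_n) (Q : 'M[R]_n -> R) :
  polynomial_fun Q -> Q J != 0 -> \det J != 0 ->
  exists d : 'I_n -> R, [/\ forall i, d i != 0, Q (scale_rows d J) != 0
    & forall z : R[i], eigenvalue (map_mx (real_complex R) (scale_rows d J)) z ->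
        complex.Re z != 0].
Proof.
move=> polyQ QJ dJ; have [d [d0 Qd dI]] := off_imaginary_pencil polyQ QJ dJ.
exists d; split=> // -[x y]; rewrite eigenvalue_root_char => /= zr.
apply: contraNneq (dI y) => x0; rewrite {x}x0 in zr.
set z := Complex 0 y in zr *.
rewrite -[_.[z]]/(horner_eval z _) -!det_map_mx.
have : \det (diag_mx (\row_i (- (d i)%:C%C)) *m
    map_mx (horner_eval z) (map_mx (map_poly (real_complex R))
      (pencil J (fun i => (d i)^-1)))) = 0.
  move: zr; rewrite rootE -[_.[z]]/(horner_eval z _) -det_map_mx => /eqP <-.
  congr (\det _); apply/matrixP => i j; rewrite mul_diag_mx !mxE /horner_eval.
  rewrite rmorphB rmorphM /= !map_polyC map_polyX /= !hornerE /=.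
  rewrite /horner_eval hornerD hornerN hornerMn hornerX hornerC.
  have di : (d i)%:C%C != 0 :> R[i] by rewrite fmorph_eq0.
  rewrite !rmorphM /= fmorphV.
  have [_|_] := eqVneq i j; rewrite ?rmorph1 ?rmorph0 ?mulr1n ?mulr0n; first by field.
  by ring.
move/eqP; rewrite det_mulmx mulf_eq0 det_diag => /orP[|/eqP->]; last by rewrite eqxx.
move=> /prodf_eq0[i _]; rewrite mxE oppr_eq0 fmorph_eq0 (negbTE (d0 i)).
by [].
Qed.

End Hyperbolicity.

(** * Derivatives along families of equilibria *)

Section Calculus.
Local Open Scope classical_set_scope.
Variables (R : realType) (n : nat).
Local Notation state := ('rV[R]_n * R)%type.

(** A class of differentiable functions that is closed under directional
    derivatives: its members are therefore smooth. *)
Inductive polynomial_expr : (state -> R) -> Prop :=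
| PolyCst c : polynomial_expr (cst c)
| PolyVar l : polynomial_expr (fun z => z.1 0 l)
| PolyPar : polynomial_expr (fun z => z.2)
| PolyAdd g h : polynomial_expr g -> polynomial_expr h -> polynomial_expr (g + h)
| PolyMul g h : polynomial_expr g -> polynomial_expr h -> polynomial_expr (g * h).

Lemma derive_quadratic (g : state -> R) (z v : state) (a b : R) :
  (forall t, g (t *: v + z) = g z + t * a + t ^+ 2 * b) -> 'D_v g z = a.
Proof.
move=> gE; apply: cvg_lim => //.
have -> : (fun t : R => t^-1 *: (g (t *: v + z) - g z)) = fun t => t^-1 * (t * (a + t * b)).
  by apply/funext => t; rewrite gE /GRing.scale /=; congr (_ * _); ring.
have lin : (fun t : R => a + t * b) @ 0^' --> a.
  apply: cvg_trans (cvg_app _ (@nbhs_dnbhs _ (0 : R))) _.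
  pose p : {poly R} := a%:P + 'X * b%:P.
  have -> : (fun t : R => a + t * b) = horner p.
    by apply/funext => t; rewrite !hornerE.
  have p0 : p.[0] = a by rewrite !hornerE.
  rewrite -[X in _ --> X]p0; exact: continuous_horner.
apply: cvg_trans lin; apply: near_eq_cvg.
near=> t; rewrite mulKf//; near: t.
exact: nbhs_dnbhs_neq.
Unshelve. all: by end_near. Qed.

Lemma differentiable_fst (z : state) : differentiable (fst : state -> 'rV[R]_n) z.
Proof.
have flin : linear (fst : state -> 'rV[R]_n) by [].
pose fM := GRing.isLinear.Build _ _ _ _ _ flin.
pose f : {linear state -> 'rV[R]_n} := HB.pack (fst : state -> 'rV[R]_n) fM.
by apply: (@linear_differentiable _ _ _ f) => y; exact: cvg_fst.
Qed.

Lemma differentiable_snd (z : state) : differentiable (snd : state -> R) z.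
Proof.
have flin : linear (snd : state -> R) by [].
pose fM := GRing.isLinear.Build _ _ _ _ _ flin.
pose f : {linear state -> R} := HB.pack (snd : state -> R) fM.
by apply: (@linear_differentiable _ _ _ f) => y; exact: cvg_snd.
Qed.

Lemma differentiable_polynomial (g : state -> R) :
  polynomial_expr g -> forall z, differentiable g z.
Proof.
elim=> [c|l||f h _ IHf _ IHh|f h _ IHf _ IHh] z.
- exact: differentiable_cst.
- apply: (@differentiable_comp _ _ _ _ fst (fun x : 'rV[R]_n => x 0 l)).
    exact: differentiable_fst.
  exact: differentiable_coord.
- exact: differentiable_snd.
- exact: differentiableD.
- exact: differentiableM.
Qed.

Lemma derive_polynomial (g : state -> R) v :
  polynomial_expr g -> polynomial_expr (fun z => 'D_v g z).
Proof.
elim=> [c|l||f h pf IHf ph IHh|f h pf IHf ph IHh].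
- rewrite (_ : (fun z => _) = cst 0); first exact: PolyCst.
  by apply/funext => z; rewrite (@derive_quadratic _ _ _ 0 0)// => t; rewrite /cst; ring.
- rewrite (_ : (fun z => _) = cst (v.1 0 l)); first exact: PolyCst.
  apply/funext => z; rewrite (@derive_quadratic _ _ _ (v.1 0 l) 0)// => t.
  by rewrite /= !mxE; ring.
- rewrite (_ : (fun z => _) = cst v.2); first exact: PolyCst.
  apply/funext => z; rewrite (@derive_quadratic _ _ _ v.2 0)// => t.
  by rewrite /= /GRing.scale /=; ring.
- rewrite (_ : (fun z => _) = (fun z => 'D_v f z) + (fun z => 'D_v h z)); first exact: PolyAdd.
  apply/funext => z; rewrite deriveD//; apply: diff_derivable; exact: differentiable_polynomial.
rewrite (_ : (fun z => _) = f * (fun z => 'D_v h z) + h * (fun z => 'D_v f z)).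
  by apply: PolyAdd; apply: PolyMul.
by apply/funext => z; rewrite deriveM//; apply: diff_derivable; exact: differentiable_polynomial.
Qed.

Lemma smooth_polynomial (f : state -> 'rV[R]_n) :
  (forall j, polynomial_expr (fun z => f z 0 j)) -> smooth f.
Proof.
move=> pf j k; elim: k (fun z => f z 0 j) (pf j) => [|k IH] g pg /=.
  by move=> z; apply: differentiable_continuous; exact: differentiable_polynomial.
split=> [|v]; first exact: differentiable_polynomial.
by apply: IH; exact: derive_polynomial.
Qed.

Lemma PolySum (I : finType) (P : pred I) (F : I -> state -> R) :
  (forall i, polynomial_expr (F i)) -> polynomial_expr (fun z => \sum_(i | P i) F i z).
Proof.
move=> pF; rewrite (_ : (fun z => _) = \sum_(i | P i) F i); last first.
  by apply/funext => z; rewrite fct_sumE.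
elim/big_rec: _ => [|i g _ pg]; [exact: (PolyCst 0)|exact: PolyAdd].
Qed.

(** Differentiation of [f (X I, I) = 0] with respect to [I]. *)
Lemma derive_along_family (f : state -> 'rV[R]_n) X0 I0 X j :
  smooth f -> equilibrium_family f X0 I0 X ->
  \sum_l partial_x f j l (X0, I0) * derive1 (fun I => X I 0 l) I0
    + partial_par f j (X0, I0) = 0.
Proof.
move=> sf [XI0 dX fX].
pose g z := f z 0 j.
have dg : differentiable g (X0, I0) by have [] := sf j 1.
pose c I : state := (X I, I).
have dc : differentiable c I0.
  by apply: differentiable_pair => //; exact/derivable1_diffP.
have Xl l : derive1 (fun I => X I 0 l) I0 = ('D_1 X I0) 0 l.
  by rewrite derive_mx// mxE derive1E.
have e1 : 'D_1 (g \o c) I0 = 0.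
  rewrite -[RHS](derive_cst 0 I0 (1 : R)); apply: near_eq_derive.
  by apply: filterS fX => I /= fI; rewrite /g /c fI mxE.
have dgc : differentiable g (c I0) by rewrite /c XI0.
have e2 : 'd g (X0, I0) ('D_1 X I0, 1) = 0.
  rewrite -[RHS]e1 [RHS]deriveE; last exact: differentiable_comp.
  rewrite diff_comp// /c /= XI0 diff_pair//; last exact/derivable1_diffP.
  have d1 : 'd (@id R) I0 = id :> (R -> R) by exact: diff_val.
  have dX1 : 'd X I0 1 = 'D_1 X I0 by rewrite deriveE//; exact/derivable1_diffP.
  by rewrite /= d1 dX1.
rewrite -[RHS]e2.
have -> : ('D_1 X I0, 1) = \sum_l derive1 (fun I => X I 0 l) I0 *: (delta_mx 0 l, 0) + (0, 1) :> state.
  rewrite [RHS]surjective_pairing; congr pair.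
    rewrite linearD linear_sum /= addr0 [LHS]row_sum_delta.
    by apply: eq_bigr => l _; rewrite Xl.
  rewrite linearD linear_sum /= big1 ?add0r// => l _; exact: scaler0.
rewrite linearD linear_sum; congr (_ + _); last by rewrite /partial_par deriveE.
by apply: eq_bigr => l _; rewrite linearZ /partial_x deriveE// mulrC.
Qed.

End Calculus.

(** * A polynomial admissible system with given first derivatives *)

Section Realization.
Local Open Scope classical_set_scope.
Variables (R : realType) (n : nat) (G : io_network n).
Local Notation state := ('rV[R]_n * R)%type.

Lemma admissible_partialsP (f : state -> 'rV[R]_n) z :
  admissible G f -> admissible_partials G (partials f z).
Proof.
case=> _ _ parf arrf; split=> [j l|j jI].
  rewrite /coupled negb_or => /andP[lj nlj].
  rewrite row_mxEl mxE; apply: (arrf j l _).2 => //; by rewrite eq_sym.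
rewrite (row_mxEr _ _ j) mxE /partial_par; apply: (@derive_quadratic _ _ _ _ _ 0 0) => t.
have -> : t *: (0, 1) + z = (z.1, t *: 1 + z.2) :> state.
  by rewrite [LHS]surjective_pairing /= scaler0 add0r.
by rewrite !mulr0 !addr0 (parf j _ _ z.2)// -surjective_pairing.
Qed.

Variables (J : 'M[R]_n) (b : R) (u : 'I_n -> R).
Hypothesis supp_J : forall j l, ~~ coupled G l j -> J j l = 0.
Hypothesis equil : forall j, \sum_l J j l * u l + (j == inode G)%:R * b = 0.

(** The quadratic terms vanish to first order at the origin and along the line
    spanned by [u], which is thus a family of equilibria, while their derivative
    in [x_l] is [x_j]: this makes every arrow effective even where [J j l = 0].
    Where [u j = 0], the convention [u l / 0 = 0] leaves [x_j * x_l], which also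
    vanishes on the line. *)
Definition realization (z : state) : 'rV[R]_n :=
  \row_j (\sum_l J j l * z.1 0 l + (j == inode G)%:R * b * z.2
    + \sum_(l | (l != j) && arrow G l j) z.1 0 j * (z.1 0 l - u l / u j * z.1 0 j)).

Let partial_off_diag j l z : l != j ->
  partial_x realization j l z = J j l + (arrow G l j)%:R * z.1 0 j.
Proof.
move=> lj; apply: (@derive_quadratic _ _ _ _ _ _ 0) => t.
have jl : (j == l) = false by rewrite eq_sym (negbTE lj).
rewrite !mxE /= jl mulr0 !add0r scaler0 add0r mulr0 addr0.
under eq_bigr => m _ do rewrite !mxE /=.
under [in X in _ + X = _]eq_bigr => m _ do rewrite !mxE /=.
have -> : \sum_m J j m * (t * (m == l)%:R + z.1 0 m) = \sum_m J j m * z.1 0 m + t * J j l.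
  rewrite [X in t * X](_ : _ = \sum_m J j m * (m == l)%:R); last first.
    by rewrite (bigD1 l)//= eqxx mulr1 big1 ?addr0// => m /negbTE->; rewrite mulr0.
  by rewrite mulr_sumr -big_split; apply: eq_bigr => m _ /=; ring.
have -> : \sum_(m | (m != j) && arrow G m j)
      z.1 0 j * (t * (m == l)%:R + z.1 0 m - u m / u j * z.1 0 j) =
    \sum_(m | (m != j) && arrow G m j) z.1 0 j * (z.1 0 m - u m / u j * z.1 0 j)
     + t * ((arrow G l j)%:R * z.1 0 j).
  rewrite [X in t * X](_ : _ = \sum_(m | (m != j) && arrow G m j) (m == l)%:R * z.1 0 j); last first.
    have [al|al] := boolP (arrow G l j).
      rewrite (bigD1 l)/= ?lj// eqxx big1 ?addr0// => m /andP[_ /negbTE->].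
      by rewrite mul0r.
    rewrite mul0r big1// => m /andP[_ am]; case: eqP am => [->|_]; last by rewrite mul0r.
    by rewrite (negbTE al).
  by rewrite mulr_sumr -big_split; apply: eq_bigr => m _ /=; ring.
ring.
Qed.

Let partial_origin j l : partial_x realization j l (0, 0) = J j l.
Proof.
have [->|lj] := eqVneq l j; last by rewrite partial_off_diag//= mxE mulr0 addr0.
pose c := \sum_(m | (m != j) && arrow G m j) - (u m / u j).
apply: (@derive_quadratic _ _ _ _ _ _ c) => t.
rewrite !mxE /= !addr0 scaler0 !mulr0 !addr0.
have -> : \sum_m J j m * (t *: delta_mx 0 j : 'rV[R]_n) 0 m = t * J j j.
  rewrite (bigD1 j)//= big1 => [|m mj]; rewrite !mxE /= ?eqxx ?(negbTE mj) ?mulr0 ?addr0 ?mulr1//.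
  exact: mulrC.
have -> : \sum_m J j m * (0 : 'rV[R]_n) 0 m = 0.
  by apply: big1 => m _; rewrite mxE mulr0.
rewrite [X in _ = _ + X + _ + _]big1 => [|m _]; last by rewrite mxE mul0r.
rewrite addr0 add0r; congr (_ + _); rewrite mulr_sumr; apply: eq_bigr => m /andP[mj _].
rewrite !mxE /= eqxx (negbTE mj) /=; ring.
Qed.

Lemma realization_partials :
  partials realization (0, 0) = row_mx J (\col_j ((j == inode G)%:R * b)).
Proof.
congr row_mx; apply/matrixP => j l; rewrite !mxE; first exact: partial_origin.
apply: (@derive_quadratic _ _ _ _ _ _ 0) => t.
rewrite !mxE /= scaler0 !mulr0 !addr0; set S := \sum_(_ < n) _; set N := \sum_(_ < n | _) _.
have -> : t *: (1 : R) = t by rewrite /GRing.scale /= mulr1.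
by ring.
Qed.

Lemma realization_admissible : admissible G realization.
Proof.
split.
- apply: smooth_polynomial => j.
  rewrite (_ : (fun z => _) = (fun z => \sum_l ((cst (J j l) * (fun z : state => z.1 0 l)) z))
    + (cst ((j == inode G)%:R * b) * snd)
    + (fun z => \sum_(l | (l != j) && arrow G l j)
         ((fun z : state => z.1 0 j) * ((fun z : state => z.1 0 l)
           + cst (- (u l / u j)) * (fun z : state => z.1 0 j))) z)); last first.
    apply/funext => z; rewrite mxE /=; congr (_ + _).
    by apply: eq_bigr => l _; rewrite mulNr.
  have var l := @PolyVar R n l; have par := @PolyPar R n; have cstp c := @PolyCst R n c.
  do !(apply: PolyAdd || apply: PolySum => l || apply: PolyMul) => //.
- move=> j x y I xy; rewrite !mxE /=; congr (_ + _ + _).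
    apply: eq_bigr => l _; have [/xy->//|/supp_J->] := boolP (coupled G l j).
    by rewrite !mul0r.
  have xyj : x 0 j = y 0 j by apply: xy; rewrite /coupled eqxx.
  apply: eq_bigr => l /andP[_ al]; rewrite xyj (xy l)//.
  by rewrite /coupled al orbT.
- by move=> j x I I' /negbTE jI; rewrite !mxE /= jI !mul0r.
move=> j l jl; rewrite eq_sym in jl; split=> [p0|al z].
  apply/negP => al; have := p0 ((const_mx (1 - J j l)), 0).
  rewrite partial_off_diag// al /= mxE mul1r addrC subrK => /eqP.
  by rewrite oner_eq0.
rewrite partial_off_diag// (negbTE al) mul0r addr0 supp_J//.
by rewrite /coupled (negbTE jl).
Qed.

Lemma realization_family :
  equilibrium_family realization 0 0 (fun t => t *: \row_l u l).
Proof.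
have fam t : realization (t *: \row_l u l, t) = 0.
  apply/rowP => j; rewrite !mxE /= [X in _ + X]big1 ?addr0; last first.
    move=> l _; rewrite !mxE; have [->|uj] := eqVneq (u j) 0; first by rewrite mulr0 mul0r.
    by apply/eqP; rewrite mulf_eq0; apply/orP; right; rewrite subr_eq0; apply/eqP; field.
  transitivity (t * (\sum_l J j l * u l + (j == inode G)%:R * b)); last first.
    by rewrite equil mulr0.
  rewrite mulrDr mulr_sumr; congr (_ + _); last by ring.
  by apply: eq_bigr => l _; rewrite !mxE; ring.
split; first by rewrite scale0r.
  exact/derivable1_diffP/differentiableZl.
by apply: filterE => t; exact: fam.
Qed.

Lemma realization_origin : realization (0, 0) = 0.
Proof. by have [_ _ /nbhs_singleton] := realization_family; rewrite scale0r. Qed.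

Lemma realization_derivative k :
  derive1 (fun t : R => (t *: \row_l u l : 'rV[R]_n) 0 k) 0 = u k.
Proof.
rewrite (_ : (fun t => _) = horner ('X * (u k)%:P)); last first.
  by apply/funext => t; rewrite !mxE !hornerE.
by rewrite -derivE derivM derivX derivC mulr0 addr0 mul1r hornerC.
Qed.

End Realization.

(** * Matching rows and columns of a core network *)

Section Matching.
Variables (n : nat) (G : io_network n).
Local Notation o := (onode G).
Hypothesis coreG : core G.

Lemma path_permutation : exists psi : 'S_n,
  psi o = inode G /\ forall q, q != o -> coupled G q (psi q).
Proof.
have [_ /connectP[p0 pp0 lp0]] := coreG (inode G).
case/shortenP: pp0 lp0 => p pp up _ lp {p0}.
set s := inode G :: p in up.
have next_inj : injective (next s) := can_inj (prev_next up).
pose f q := if q \in s then next s q else q.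
have f_inj : injective f.
  move=> q r; rewrite /f; case: ifPn => qs; case: ifPn => rs //; first exact: next_inj.
    by move=> qr; rewrite -qr mem_next qs in rs.
  by move=> qr; rewrite qr mem_next rs in qs.
have os : o \in s by rewrite lp mem_last.
have ilast : index o s = size p by rewrite lp index_last.
exists (perm f_inj); split=> [|q qo]; rewrite permE /f.
  by rewrite os next_nth os -[LHS]/(nth (inode G) p (index o s)) ilast nth_default.
case: ifP => [qs|_]; last by rewrite /coupled eqxx.
rewrite /coupled; apply/orP; right; rewrite next_nth qs.
have lt_qp : (index q s < size p)%N.
  rewrite ltn_neqAle -ltnS -[(size p).+1]/(size s) index_mem qs andbT.
  by apply: contra qo; rewrite -ilast => /eqP/index_inj->.
rewrite -[X in arrow G X _](nth_index (inode G) qs).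
exact: (pathP (inode G) pp).
Qed.

Variable psi : 'S_n.
Hypotheses (psi_o : psi o = inode G) (psi_coupled : forall q, q != o -> coupled G q (psi q)).

Definition dependency : rel 'I_n := [rel j l | coupled G l (psi j)].

(** Otherwise the set [U] of nodes that paths from [j] lead to is stable under
    [psi], closed under incoming arrows, and misses the input. *)
Lemma dependency_to_output j : connect dependency j o.
Proof.
apply/negPn/negP => jo.
pose U := [set l | connect dependency j l].
have stepU l q : l \in U -> coupled G q (psi l) -> q \in U.
  by rewrite !inE => jl lq; apply: connect_trans jl (connect1 _).
have psiU : [set psi l | l in U] = U.
  apply/eqP; rewrite eqEcard card_imset ?leqnn ?andbT; last exact: perm_inj.
  apply/fintype.subsetP => _ /imsetP[l lU ->]; apply: stepU lU _.
  by rewrite /coupled eqxx.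
have iU : inode G \in ~: U.
  rewrite inE -psiU -psi_o mem_imset; last exact: perm_inj.
  by rewrite inE.
have jU : j \notin ~: U by rewrite !inE negbK connect0.
have [a [b [aU bU ab _ _]]] := connect_exit (coreG j).1 iU jU.
move: bU; rewrite inE negbK -psiU => /imsetP[l lU bl].
move: aU; rewrite inE (stepU l)//.
by rewrite -bl /coupled ab orbT.
Qed.

(** Otherwise the set [L] of nodes with a path to [j] is stable under [psi],
    closed under outgoing arrows, and misses the output. *)
Lemma dependency_from_output j : connect dependency o j.
Proof.
apply/negPn/negP => jo.
pose L := [set l | connect dependency l j].
have stepL l q : l \in L -> coupled G l (psi q) -> q \in L.
  by rewrite !inE => lj lq; apply: connect_trans (connect1 _) lj.
have psiL : [set (psi^-1)%g l | l in L] = L.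
  apply/eqP; rewrite eqEcard card_imset ?leqnn ?andbT; last exact: perm_inj.
  apply/fintype.subsetP => _ /imsetP[l lL ->]; apply: stepL lL _.
  by rewrite permKV /coupled eqxx.
have jL : j \in L by rewrite inE connect0.
have oL : o \notin L by rewrite inE.
have [a [b [aL bL ab _ _]]] := connect_exit (coreG j).2 jL oL.
have : (psi^-1)%g b \in L.
  by apply: stepL aL _; rewrite permKV /coupled ab orbT.
by rewrite -psiL mem_imset ?(negbTE bL)//; exact: perm_inj.
Qed.

End Matching.

(** * Homeostasis blocks as strongly connected components *)

Lemma perm_to_final_segment k (Y : {set 'I_k}) :
  exists s : 'S_k, forall i, (s i \in Y) = (k - #|Y| <= i)%N.
Proof.
pose l := enum (~: Y) ++ enum Y.
have ul : uniq l.
  rewrite cat_uniq !enum_uniq andbT /=; apply/hasPn => i; rewrite !mem_enum inE.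
  by rewrite negbK.
have szC : size (enum (~: Y)) = (k - #|Y|)%N by rewrite -cardE cardsCs finset.setCK card_ord.
have szl : size l = k.
  by rewrite size_cat szC -cardE subnK// -[X in (_ <= X)%N]card_ord max_card.
pose f (i : 'I_k) := nth i l i.
have fE (i j : 'I_k) : f i = nth j l i by apply: set_nth_default; rewrite szl.
have f_inj : injective f.
  move=> i j; rewrite (fE i j) => /eqP; rewrite nth_uniq ?szl// => /eqP; exact: val_inj.
exists (perm f_inj) => i; rewrite permE /f nth_cat szC ltnNge.
have [lei|lti] := leqP (k - #|Y|) i; rewrite /=.
  rewrite -mem_enum mem_nth// -szC ltn_subLR ?szC// -szC -size_cat.
  by rewrite szl.
have : nth i (enum (~: Y)) i \in enum (~: Y) by rewrite mem_nth// szC.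
by rewrite mem_enum inE => /negbTE.
Qed.

Lemma perm_mulmxE (S : nzRingType) k (A : 'M[S]_k) (s t : 'S_k) i j :
  (perm_mx s *m A *m perm_mx t) i j = A (s i) ((t^-1)%g j).
Proof. by rewrite -row_permE -[t in perm_mx t]invgK -col_permE !mxE. Qed.

Lemma permuted_blocksE (S : nzRingType) k (A : 'M[S]_k) m (p : 'I_m -> nat)
    (sum_p : (\sum_i p i)%N = k) (s t : 'S_k) i j (a : 'I_(p i)) (b : 'I_(p j)) :
  submxblock (permuted_blocks A sum_p s t) i j a b =
  A (s (cast_ord sum_p (tagnat.Rank _ a))) ((t^-1)%g (cast_ord sum_p (tagnat.Rank _ b))).
Proof. by rewrite mxE castmxE /= perm_mulmxE !esymK. Qed.

(** The zero rectangle with rows [Y] and columns outside [X] is moved to the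
    lower left corner, and is exactly as large as a block there. *)
Lemma block_triangularizable_rectangle (S : nzRingType) k (A : 'M[S]_k)
    (X Y : {set 'I_k}) :
  X != finset.set0 -> X != [set: 'I_k] -> #|X| = #|Y| ->
  (forall a b, a \in Y -> b \notin X -> A a b = 0) -> block_triangularizable A.
Proof.
move=> X0 XT XY A0.
have leX : (#|X| <= k)%N by rewrite -[X in (_ <= X)%N]card_ord max_card.
have [s sE] := perm_to_final_segment Y; have [t tE] := perm_to_final_segment X.
pose p (i : 'I_2) := if i == 0 then (k - #|X|)%N else #|X|.
have sum_p : (\sum_i p i)%N = k.
  by rewrite !big_ord_recl big_ord0 addn0 /p /= subnK.
(* Column permutations act by the inverse, hence t^-1. *)
exists 2%N, p, sum_p, s, (t^-1)%g; split=> // [i|i j].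
  rewrite /p; case: eqP => _; last by rewrite card_gt0.
  rewrite subn_gt0 ltn_neqAle leX andbT; apply: contra XT => /eqP cX.
  by rewrite eqEcard finset.subsetT cardsT card_ord cX leqnn.
case: i => -[|[|//]] Hi //; case: j => -[|[|//]] Hj // _.
apply/matrixP => a b; rewrite permuted_blocksE invgK [RHS]mxE; apply: A0.
  rewrite sE [X in (_ <= X)%N](tagnat.RankEsum a) (bigD1 0)//= -XY.
  by rewrite -addnA leq_addr.
rewrite tE -ltnNge [X in (X < _)%N](tagnat.RankEsum b) big_pred0// add0n.
by rewrite (leq_trans (ltn_ord b)).
Qed.

Section NormalForm.
Variables (R : realType) (n : nat) (G : io_network n).
Variable T : homeostasis_normal_form R G.
Local Notation o := (onode G).
Local Notation position := {i : 'I_(nblocks T) & 'I_(block_size i)}.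

Definition row_node i (a : 'I_(block_size (h := T) i)) : 'I_n :=
  lift (inode G) (row_order T (cast_ord (sum_block_size T) (tagnat.Rank _ a))).

Definition col_node i (b : 'I_(block_size (h := T) i)) : 'I_n :=
  lift o ((col_order T)^-1%g (cast_ord (sum_block_size T) (tagnat.Rank _ b))).

Lemma PHQ_entry i j (a : 'I_(block_size i)) (b : 'I_(block_size j)) :
  submxblock (PHQ T) i j a b = generic_jacobian R G (row_node a) (col_node b).
Proof. by rewrite permuted_blocksE mxE mxE. Qed.

Definition row_at (x : position) := row_node (tagged x).
Definition col_at (x : position) := col_node (tagged x).

Lemma col_at_inj : injective col_at.
Proof.
rewrite /col_at /col_node => x y /lift_inj/perm_inj/cast_ord_inj; rewrite -!tagnat.rankE.
exact: tagnat.rank_inj.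
Qed.

Lemma col_node_inj i : injective (@col_node i).
Proof.
move=> b c bc; have /eqP : Tagged _ b = Tagged _ c :> position by exact: col_at_inj.
by rewrite eq_Tagged => /eqP.
Qed.

Lemma row_atP p : p != inode G -> exists x, row_at x = p.
Proof.
rewrite eq_sym => /unlift_some[q -> _].
exists (tagnat.sig (cast_ord (esym (sum_block_size T)) ((row_order T)^-1%g q))).
by rewrite /row_at /row_node -tagnat.rankE tagnat.sigK cast_ordKV permKV.
Qed.

Lemma col_atP q : q != o -> exists x, col_at x = q.
Proof.
rewrite eq_sym => /unlift_some[p -> _].
exists (tagnat.sig (cast_ord (esym (sum_block_size T)) (col_order T p))).
by rewrite /col_at /col_node -tagnat.rankE tagnat.sigK cast_ordKV permK.
Qed.

Lemma col_node_neq i (b : 'I_(block_size (h := T) i)) : col_node b != o.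
Proof. by rewrite eq_sym neq_lift. Qed.

Lemma indet_neq0 (j l : 'I_n) : indet R j l != 0 :> mpoly.mpoly (n * (n + 1)) R.
Proof.
apply/eqP => /(congr1 (mpoly.mcoeff (mpoly.mnm1 (mxvec_index j (lshift 1 l))))).
by rewrite mpoly.mcoeffX mpoly.mcoeff0 eqxx => /eqP; rewrite oner_eq0.
Qed.

Lemma indet_inj (j l j' l' : 'I_n) : indet R j l = indet R j' l' -> j = j' /\ l = l'.
Proof.
move=> /(congr1 (mpoly.mcoeff (mpoly.mnm1 (mxvec_index j' (lshift 1 l'))))).
rewrite !mpoly.mcoeffX eqxx mpoly.eq_mnm1 => /eqP; rewrite eqr_nat eqb1 => /eqP.
by move=> /cast_ord_inj/enum_rank_inj[-> /val_inj->].
Qed.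

Lemma block_coupled_le (x y : position) :
  coupled G (col_at y) (row_at x) -> (tag x <= tag y)%N.
Proof.
move=> xy; rewrite leqNgt; apply/negP => yx.
have /matrixP/(_ (tagged x) (tagged y)) := PHQ_triangular yx.
by rewrite PHQ_entry !mxE xy => /eqP; rewrite (negbTE (indet_neq0 _ _)).
Qed.

Variable psi : 'S_n.
Hypotheses (psi_o : psi o = inode G) (psi_coupled : forall q, q != o -> coupled G q (psi q)).
Local Notation h := (dependency G psi).
Local Notation g := (off_output h o).

(** Triangularity makes [psi] weakly decrease block indices. As it is a
    bijection between the columns and the rows, and each block has as many rows
    as columns, the sum of the indices is preserved, so no index decreases. *)
Lemma block_matching i : exists rho : 'I_(block_size (h := T) i) -> 'I_(block_size i),
  injective rho /\ forall b, row_node (rho b) = psi (col_node b).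
Proof.
have [f fP] : exists f : position -> position, forall x, row_at (f x) = psi (col_at x).
  apply: (@fin_all_exists _ (fun=> position) (fun x y => row_at y = psi (col_at x))) => x.
  apply: row_atP; rewrite -psi_o (inj_eq perm_inj); exact: col_node_neq.
have f_inj : injective f.
  by move=> x y fxy; apply: col_at_inj; apply: (@perm_inj _ psi); rewrite -!fP fxy.
have f_le x : (tag (f x) <= tag x)%N.
  by apply: block_coupled_le; rewrite fP psi_coupled// col_node_neq.
have tag_f x : tag (f x) = tag x.
  have := leqif_sum (fun x (_ : predT x) => leqif_eq (f_le x)).
  case=> _; rewrite [X in _ == X](reindex_inj f_inj) eqxx => /esym/forallP/(_ x)/eqP.
  exact: val_inj.
have rhoP (b : 'I_(block_size i)) : exists a : 'I_(block_size i), row_node a = psi (col_node b).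
  have := fP (Tagged _ b); have := tag_f (Tagged _ b).
  by case: (f _) => j a /= ji; subst j => <-; exists a.
have [rho rhoE] := @fin_all_exists _ (fun=> 'I_(block_size i))
  (fun b a => row_node a = psi (col_node b)) rhoP.
exists rho; split=> // b c bc.
have : Tagged _ b = Tagged _ c :> position.
  by apply: col_at_inj; apply: (@perm_inj _ psi); rewrite -!rhoE bc.
by move/eqP; rewrite eq_Tagged => /eqP.
Qed.

Lemma connect_block_le (x y : position) :
  connect g (col_at x) (col_at y) -> (tag x <= tag y)%N.
Proof.
move=> /connectP[p]; elim: p x => [|q p IH] x /=.
  by move=> _ /col_at_inj->.
move=> /andP[/and3P[xo qo xq] pq] ly.
have [z zq] := col_atP qo; rewrite -zq in xq pq ly.
apply: leq_trans (IH z pq ly).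
have [rho [_ rhoE]] := block_matching (tag x).
have -> : tag x = tag (Tagged (fun i => 'I_(block_size (h := T) i)) (rho (tagged x))) by [].
by apply: block_coupled_le; rewrite /row_at /= rhoE.
Qed.

(** The columns reachable from a column within its block, with the rows matched
    to them, would form a zero rectangle contradicting irreducibility. *)
Lemma component_block i (b : 'I_(block_size (h := T) i)) :
  component h o (col_node b) = [set col_node c | c : 'I_(block_size i)].
Proof.
have block_connect (b' c : 'I_(block_size (h := T) i)) :
    connect g (col_node b') (col_node c).
  pose X := [set d : 'I_(block_size (h := T) i) | connect g (col_node b') (col_node d)].
  have [rho [rho_inj rhoE]] := block_matching i.
  suff XT : X = [set: _] by have := finset.in_setT c; rewrite -XT inE.
  apply/eqP/negPn/negP => XT; apply: (@PHQ_finest _ _ _ T i).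
  apply: (@block_triangularizable_rectangle _ _ _ X [set rho d | d in X]) => //.
  - by apply/set0Pn; exists b'; rewrite inE connect0.
  - by rewrite card_imset.
  move=> _ d /imsetP[d' d'X ->] dX; rewrite PHQ_entry mxE rhoE ifN//.
  apply: contra dX => hd; move: d'X; rewrite !inE => d'X.
  apply: connect_trans d'X (connect1 _).
  by apply/and3P; split=> //; exact: col_node_neq.
apply/setP => q; apply/idP/imsetP => [|[c _ ->]]; last by rewrite inE !block_connect.
rewrite inE => /andP[bq qb].
have qo : q != o.
  apply: contraTneq qb => ->.
  by have := output_not_reaching h (col_node_neq b); rewrite inE.
have [[j c] xq] := col_atP qo; rewrite -xq in bq qb *.
have := connect_block_le (x := Tagged _ b) bq.
have := connect_block_le (y := Tagged _ b) qb.
rewrite /= => ij ji; have e : i = j by apply/val_inj/anti_leq/andP.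
by subst j; exists c.
Qed.

End NormalForm.

(** * Evaluating polynomials in the partial derivatives *)

Section Evaluation.
Variables (R : realType) (n : nat) (G : io_network n).

Lemma eval_partials_sum (D : 'M[R]_(n, n + 1)) q :
  eval_partials D q =
  \sum_(m <- mpoly.msupp q) mpoly.mcoeff m q * \prod_i mxvec D 0 i ^+ m i.
Proof. exact: mpoly.mevalE. Qed.

Lemma polynomial_fun_eval q : polynomial_fun (fun D => @eval_partials R n D q).
Proof.
move=> P; pose v := mxvec (\matrix_(i, j) P i j).
exists (\sum_(m <- mpoly.msupp q) (mpoly.mcoeff m q)%:P * \prod_i v 0 i ^+ m i) => t.
rewrite eval_partials_sum horner_sum; apply: eq_bigr => m _.
rewrite hornerM hornerC horner_prod; congr (_ * _); apply: eq_bigr => i _.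
by rewrite horner_exp; case/mxvec_indexP: i => i j; rewrite !mxvecE !mxE.
Qed.

Lemma eval_generic_jacobian (D : 'M[R]_(n, n + 1)) j l : admissible_partials G D ->
  eval_partials D (generic_jacobian R G j l) = D j (lshift 1 l).
Proof.
case=> D0 _; rewrite mxE; case: ifPn => [_|/D0->]; last exact: rmorph0.
by rewrite /eval_partials mpoly.mevalXU mxvecE.
Qed.

Lemma eval_det k (D : 'M[R]_(n, n + 1)) (A : 'M[mpoly.mpoly (n * (n + 1)) R]_k) :
  eval_partials D (\det A) = \det (\matrix_(i, j) eval_partials D (A i j)).
Proof.
rewrite /eval_partials -[LHS]det_map_mx; congr (\det _).
by apply/matrixP => i j; rewrite !mxE.
Qed.

Lemma polynomial_fun_jacobian q (b : 'cV[R]_n) :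
  polynomial_fun (fun J => eval_partials (row_mx J b) q).
Proof.
move=> P.
have [r rP] := polynomial_fun_eval q (fun i k =>
  match fintype.split k with inl l => P i l | inr m => (b i m)%:P end).
exists r => t; rewrite rP; congr eval_partials; apply/matrixP => i k; rewrite !mxE.
by case: fintype.split => l; rewrite ?mxE ?hornerC.
Qed.

Lemma polynomial_fun_row_perm (Q : 'M[R]_n -> R) (s : 'S_n) :
  polynomial_fun Q -> polynomial_fun (fun M => Q (row_perm s M)).
Proof.
move=> polyQ P; have [r rP] := polyQ (fun i j => P (s i) j); exists r => t.
by rewrite rP; congr Q; apply/matrixP => i j; rewrite !mxE.
Qed.

End Evaluation.

(** * Nodes induced by a homeostasis subnetwork *)

Section Induction.
Variables (R : realType) (n : nat) (G : io_network n).
Variable T : homeostasis_normal_form R G.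
Local Notation o := (onode G).
Local Notation iota := (inode G).
Variable psi : 'S_n.
Hypotheses (coreG : core G) (psi_o : psi o = iota) (psi_coupled : forall q, q != o -> coupled G q (psi q)).
Local Notation h := (dependency G psi).

Lemma psi_neq j : j != o -> psi j != iota.
Proof. by rewrite -psi_o (inj_eq perm_inj). Qed.

Variables (eta : 'I_(nblocks T)) (b : 'I_(block_size eta)).
Local Notation e := (col_node b).
Local Notation C := (component h o e).
Local Notation L := (reaching h o e).

Let e_neq_o : e != o := col_node_neq b.

Lemma supported_jacobian (J : 'M[R]_n) :
  (forall j l, ~~ coupled G l j -> J j l = 0) -> supported_on h (row_perm psi J).
Proof. by move=> J0 j l hjl; rewrite mxE J0. Qed.

Lemma sum_component (F z : 'I_n -> R) : (forall j, j \notin C -> z j = 0) ->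
  \sum_l F l * z l = \sum_(c < block_size eta) F (col_node c) * z (col_node c).
Proof.
move=> zC; rewrite (bigID (mem C))/= [X in _ + X]big1 ?addr0 => [|l /zC->]; last by rewrite mulr0.
rewrite (component_block psi_o psi_coupled) big_imset//= => c d _ _; exact: col_node_inj.
Qed.

(** [z] is a kernel vector of the block, transported along [col_node] and
    extended by zero. *)
Lemma inducingP (D : 'M[R]_(n, n + 1)) : admissible_partials G D ->
  homeostasis_inducing eta D <-> exists z : 'I_n -> R,
    [/\ forall j, j \notin C -> z j = 0, exists j, z j != 0
      & forall j, j \in C -> \sum_l D (psi j) (lshift 1 l) * z l = 0].
Proof.
move=> admD; have [rho [rho_inj rhoE]] := block_matching psi_o psi_coupled eta.
have CE := component_block psi_o psi_coupled b.
rewrite /homeostasis_inducing eval_det.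
pose A : 'M[R]_(block_size eta) := \matrix_(a, c) D (row_node a) (lshift 1 (col_node c)).
have -> : (\matrix_(a, c) eval_partials D (homeostasis_block eta a c)) = A.
  by apply/matrixP => a c; rewrite [LHS]mxE [RHS]mxE /homeostasis_block PHQ_entry eval_generic_jacobian.
have colI : injective (@col_node _ _ _ T eta) by exact: col_node_inj.
rewrite det0_kernel; split=> [[v [[c vc] Av]]|[z [zC [j zj] Dz]]].
  pose z l := if [pick d | col_node d == l] is Some d then v d else 0.
  have zcol d : z (col_node d) = v d.
    rewrite /z; case: pickP => [d' /eqP/colI->//|/(_ d)]; by rewrite eqxx.
  have zC l : l \notin C -> z l = 0.
    rewrite CE /z; case: pickP => [d /eqP<-|//]; by rewrite imset_f.
  exists z; split=> // [|l]; first by exists (col_node c); rewrite zcol.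
  rewrite {1}CE => /imsetP[d _ ->]; rewrite (sum_component _ zC) -[RHS](Av (rho d)).
  by apply: eq_bigr => d' _; rewrite mxE zcol rhoE.
exists (z \o @col_node _ _ _ T eta); split.
  have : j \in C by apply: contraR zj => /zC->.
  by rewrite CE => /imsetP[d _ jd]; exists d; rewrite /= -jd.
move=> a; have /codomP[d ->] : a \in codom rho by apply/codomP; exists (invF rho_inj a); rewrite f_invF.
rewrite -[RHS](Dz (col_node d)); last by rewrite CE imset_f.
by rewrite (sum_component _ zC); apply: eq_bigr => d' _; rewrite mxE rhoE.
Qed.

Let h_refl j : j != o -> h j j. Proof. exact: psi_coupled. Qed.

(** The genericity condition is that the minor on the nodes reaching the
    component from outside is nonzero. The kernel vector given by
    [kernel_extension] is then supported on reaching nodes, and the derivative of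
    any family of equilibria is proportional to it. *)
Lemma not_reaching_induced k : k \notin L -> induces_node eta k.
Proof.
move=> kL; pose X := L :\: C.
pose q := \det (masked X 1 (row_perm psi (generic_jacobian R G))).
have qE D : admissible_partials G D ->
    eval_partials D q = \det (masked X 1 (row_perm psi (lsubmx D))).
  move=> admD; rewrite eval_det; congr (\det _); apply/matrixP => i j.
  rewrite [LHS]mxE [in LHS]mxE [RHS]mxE; case: ifP => _.
    by rewrite [in LHS]mxE eval_generic_jacobian// [RHS]mxE [RHS]mxE.
  by rewrite /eval_partials rmorphMn rmorph1.
(* Ones at the matched positions outside the component, zeros elsewhere, so that
   the block itself vanishes. *)
exists q; split.
  pose D : 'M[R]_(n, n + 1) := row_mx (\matrix_(p, l) ((psi l == p) && (l \in X))%:R) 0.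
  have admD : admissible_partials G D.
    split=> [j l|j _]; last by rewrite (row_mxEr _ _ j) mxE.
    rewrite row_mxEl mxE; case: eqP => //= <-; rewrite inE.
    have [lL|_] := boolP (l \in L); last by rewrite andbF.
    by rewrite psi_coupled// (reaching_neq_output e_neq_o lL).
  exists D; split=> //.
    apply/inducingP => //; exists (fun l => (l == e)%:R); split.
    - move=> j jC; case: eqP => // je; move: jC.
      by rewrite je inE connect0.
    - by exists e; rewrite eqxx oner_eq0.
    move=> j jC; apply: big1 => l _; rewrite row_mxEl mxE (inj_eq perm_inj).
    by case: eqP => [->|_]; rewrite ?mul0r// inE jC mul0r.
  rewrite qE// row_mxKl (_ : masked _ _ _ = 1%:M) ?det1 ?oner_eq0//.
  apply/matrixP => i j; rewrite !mxE (inj_eq perm_inj) eq_sym.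
  by case: ifP => // /andP[_ ->]; rewrite andbT.
move=> f X0 I0 admf [_ hyp] indf qf Y famY.
have admD := admissible_partialsP (X0, I0) admf.
set J := state_jacobian f (X0, I0) in hyp.
pose M := row_perm psi J.
have JE : lsubmx (partials f (X0, I0)) = J by rewrite row_mxKl.
have sM : supported_on h M.
  apply: supported_jacobian => j l ljc.
  by have := admD.1 j l ljc; rewrite row_mxEl.
have dJ : \det J != 0.
  apply/negP => J0; have /(_ _)/negP := hyp 0; apply => //=.
  apply/eigenvalueP; have /det0P[v v0 vJ] : \det (map_mx (real_complex R) J) == 0.
    by rewrite det_map_mx (eqP J0) rmorph0.
  by exists v => //; rewrite vJ scale0r.
have dM : \det M != 0.
  rewrite /M row_permE det_mulmx mulf_neq0// det_perm signr_eq0//.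
have /(inducingP admD)[z [zC [j0 zj0] Dz]] := indf.
have Mz j : j \in C -> \sum_l M j l * z l = 0.
  move=> jC; rewrite -[RHS](Dz j jC); apply: eq_bigr => l _.
  by rewrite row_mxEl mxE.
have dK : \det (masked X 1 M) != 0 by move: qf; rewrite qE// JE.
have [w [Mw wU wz]] := kernel_extension e_neq_o sM (oner_neq0 _) dK zC Mz.
pose u l := derive1 (fun I => Y I 0 l) I0.
have Mu : annihilates o M u.
  move=> j jo; have smf : smooth f by case: admf.
  have := derive_along_family (psi j) smf famY.
  have := admD.2 _ (psi_neq jo); rewrite (row_mxEr _ _ (psi j)) mxE => ->; rewrite addr0.
  by move=> E; rewrite -[RHS]E; apply: eq_bigr => l _; rewrite !mxE.
have jC0 : j0 \in C by apply: contraR zj0 => /zC->.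
have wj0 : w j0 != 0 by rewrite wz.
have [c uE] := annihilated_line dM Mw (ex_intro (fun j => w j != 0) j0 wj0) Mu.
by rewrite -/(u k) uE wU// mulr0.
Qed.

(** Any genericity polynomial [q] is nonzero at the derivatives of some
    admissible system for which [det B_eta = 0] and the derivative of the node
    [e] is not zero. The parameter derivative is made nonzero beforehand, so that
    only the Jacobian varies afterwards. *)
Lemma not_self_induced : ~ induces_node eta e.
Proof.
move=> [q [[D [admD indD qD]] qind]].
pose pulse c : 'cV[R]_n := \col_j ((j == iota)%:R * c).
have [c c0 qc] : exists2 c, c != 0 & eval_partials (row_mx (lsubmx D) (pulse c)) q != 0.
  have [r rP] := polynomial_fun_line D (row_mx 0 (pulse 1)) (polynomial_fun_eval q).
  have r0 : r != 0.
    by apply: contraNneq qD => r0; rewrite -[D]addr0 -(scale0r (row_mx 0 (pulse 1))) -rP r0 horner0.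
  pose d := D iota (rshift n ord0).
  have Xd : 'X + d%:P != 0 by rewrite monic_neq0// monicXaddC.
  have [t] := poly_nonroot (mulf_neq0 r0 Xd).
  rewrite !hornerE mulf_eq0 negb_or => /andP[rt td]; exists (t + d) => //.
  suff <- : D + t *: row_mx 0 (pulse 1) = row_mx (lsubmx D) (pulse (t + d)) by rewrite -rP.
  rewrite -[D in LHS]hsubmxK scale_row_mx add_row_mx scaler0 addr0.
  congr row_mx; apply/matrixP => i j; rewrite !mxE mulr1 (ord1 j).
  have [->|iI] := eqVneq i iota; first by rewrite mulr1 mul1r addrC.
  by rewrite admD.2// mulr0 mul0r addr0.
have suppD : supported_on h (row_perm psi (lsubmx D)).
  by apply: supported_jacobian => j l jl; rewrite mxE admD.1.
(* From here on the parameter column stays equal to pulse c. *)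
pose Q1 J := eval_partials (row_mx J (pulse c)) q.
have polyQ1 : polynomial_fun Q1 := polynomial_fun_jacobian q (pulse c).
pose Q2 (M : 'M[R]_n) := Q1 (row_perm psi^-1%g M).
have polyQ2 : polynomial_fun Q2 := polynomial_fun_row_perm psi^-1%g polyQ1.
have psiK (J : 'M[R]_n) : row_perm psi^-1%g (row_perm psi J) = J.
  by apply/matrixP => i j; rewrite !mxE permKV.
have /(inducingP admD)[z [zC z0 Dz]] := indD.
have Q2D : Q2 (row_perm psi (lsubmx D)) != 0 by rewrite /Q2 psiK.
have Mz j : j \in C -> \sum_l row_perm psi (lsubmx D) j l * z l = 0.
  by move=> jC; rewrite -[RHS](Dz j jC); apply: eq_bigr => l _; rewrite !mxE.
have [M [u [sM QM Mu uL dM]]] := generic_homeostasis_point h_refl e_neq_o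
  (dependency_to_output coreG psi_o) (dependency_from_output coreG psi) polyQ2
  suppD Q2D zC z0 Mz.
pose J0 := row_perm psi^-1%g M.
have dJ0 : \det J0 != 0.
  by rewrite /J0 row_permE det_mulmx mulf_neq0// det_perm signr_eq0.
have [d [d0 Qd hyp]] := hyperbolic_scaling polyQ1 QM dJ0.
set J := scale_rows d J0 in Qd hyp.
have JE j l : J (psi j) l = d (psi j) * M j l by rewrite !mxE permK.
have Ju p : p != iota -> \sum_l J p l * u l = 0.
  move=> pI; have jo : (psi^-1)%g p != o.
    by apply: contraNneq pI => po; rewrite -psi_o -po permKV.
  transitivity (d p * \sum_l M ((psi^-1)%g p) l * u l); last by rewrite Mu ?mulr0.
  by rewrite mulr_sumr; apply: eq_bigr => l _; rewrite -{1}[p](permKV psi) JE permKV mulrA.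
pose a := \sum_l J iota l * u l.
have ue : u e != 0 by rewrite uL target_reaching.
have a0 : a != 0.
  apply: contraNneq dM => a0; apply/eqP/det0_kernel; exists u; split; first by exists e.
  move=> i; apply: (mulfI (d0 (psi i))); rewrite mulr0 mulr_sumr.
  have -> : \sum_l d (psi i) * (M i l * u l) = \sum_l J (psi i) l * u l.
    by apply: eq_bigr => l _; rewrite JE mulrA.
  by have [->|/Ju] := eqVneq (psi i) iota.
(* Normalized so that the input row gives J v + c = 0. *)
pose v l := - c / a * u l.
have suppJ j l : ~~ coupled G l j -> J j l = 0.
  move=> jl; rewrite !mxE sM ?mulr0//.
  by rewrite -[X in coupled G l X](permKV psi) in jl.
have sumv j : \sum_l J j l * v l = - c / a * \sum_l J j l * u l.
  by rewrite mulr_sumr; apply: eq_bigr => l _; rewrite mulrCA.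
have equil j : \sum_l J j l * v l + (j == iota)%:R * c = 0.
  rewrite sumv; have [->|jI] := eqVneq j iota; last by rewrite Ju// mulr0 mul0r addr0.
  by rewrite -/a divfK// mul1r addNr.
pose f := realization G J c v.
have partsE : partials f (0, 0) = row_mx J (pulse c) := realization_partials G J c v.
have JfE : state_jacobian f (0, 0) = J by have /eq_row_mx[] := partsE.
have admf : admissible G f := realization_admissible c v suppJ.
have hypf : hyperbolic_equilibrium f 0 0.
  by split; [exact: (realization_origin equil)|rewrite JfE].
have admDf := admissible_partialsP (0, 0) admf.
have indf : homeostasis_inducing eta (partials f (0, 0)).
  apply/inducingP => //; exists (fun l => if l \in C then u l else 0); split.
  - by move=> j /negbTE->.
  - by exists e; rewrite inE connect0.
  have uU j : j \notin L -> u j = 0 by rewrite -uL negbK => /eqP.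
  move=> j jC; transitivity (d (psi j) * \sum_l M j l * (if l \in C then u l else 0)).
    rewrite mulr_sumr; apply: eq_bigr => l _.
    by rewrite partsE row_mxEl JE mulrA.
  by rewrite (component_kernel e_neq_o sM Mu uU jC) mulr0.
have := qind f 0 0 admf hypf indf.
rewrite partsE => /(_ Qd) /(_ _ (realization_family equil)).
rewrite realization_derivative => /eqP; rewrite !mulf_eq0 (negbTE ue) orbF.
by rewrite oppr_eq0 invr_eq0 (negbTE a0) (negbTE c0).
Qed.

End Induction.

Theorem theorem7p3 (R : realType) (n : nat) (G : io_network n)
    (T : homeostasis_normal_form R G) (eta1 eta2 : 'I_(nblocks T)) :
  core G ->
  homeostasis_subnetwork eta1 <> homeostasis_subnetwork eta2 ->
  induced_subnetworks eta1 <> induced_subnetworks eta2.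
Proof.
move=> coreG K12 I12.
have [psi [psi_o psi_coupled]] := path_permutation coreG.
pose first eta : 'I_(block_size (h := T) eta) := Ordinal (block_size_gt0 eta).
pose e eta := col_node (first eta).
have col_sub eta (c : 'I_(block_size (h := T) eta)) :
    col_node c \in sub_nodes (homeostasis_subnetwork eta).
  have [rho [_ rhoE]] := block_matching psi_o psi_coupled eta.
  rewrite inE; apply/existsP; exists (psi (col_node c)); apply/orP; right.
  apply/existsP; exists (rho c); apply/existsP; exists c.
  by rewrite /homeostasis_block PHQ_entry mxE rhoE psi_coupled// col_node_neq.
have not_self (eta eta' : 'I_(nblocks T)) : homeostasis_subnetwork eta = homeostasis_subnetwork eta' ->
    ~ induces eta eta'.
  move=> K H; apply: (@not_self_induced _ _ _ _ psi coreG psi_o psi_coupled _ (first eta)).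
  by apply: H; rewrite -K.
have induces_unreached (eta eta' : 'I_(nblocks T)) :
    ~~ connect (off_output (dependency G psi) (onode G)) (e eta') (e eta) ->
    induces eta eta'.
  move=> unreached k kK; apply: (not_reaching_induced psi_o psi_coupled (b := first eta)).
  have colN (c : 'I_(block_size (h := T) eta')) :
      col_node c \notin reaching (dependency G psi) (onode G) (e eta).
    have : col_node c \in component (dependency G psi) (onode G) (e eta').
      by rewrite (component_block psi_o psi_coupled) imset_f.
    rewrite !inE => /andP[ec _]; apply: contra unreached; exact: connect_trans ec.
  have entry p q : block_entry eta' p q -> exists a c,
      row_node (i := eta') a = p /\ col_node (i := eta') c = q.
    move=> /existsP[a /existsP[c]]; rewrite /homeostasis_block PHQ_entry mxE.
    case: ifP => _ /eqP; first by move=> /indet_inj; exists a, c.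
    by move=> /esym/eqP; rewrite (negbTE (indet_neq0 _ _ _)).
  move: kK; rewrite inE => /existsP[q /orP[|]] /entry[a [c [ak ck]]]; last by rewrite -ck.
  have [rho [rho_inj rhoE]] := block_matching psi_o psi_coupled eta'.
  rewrite -ak -[a](f_invF rho_inj) rhoE; set d := invF _ _.
  apply: contra (colN d) => kU.
  apply: (reaching_step (col_node_neq (first eta)) (col_node_neq d) kU).
  by apply/orP; left.
have le_of (eta eta' : 'I_(nblocks T)) : induced_subnetworks eta = induced_subnetworks eta' ->
    (eta <= eta')%N.
  move=> I; apply: (connect_block_le psi_o psi_coupled
    (x := Tagged _ (first eta)) (y := Tagged _ (first eta'))).
  apply/negPn/negP => /induces_unreached H.
  have : induced_subnetworks eta' (homeostasis_subnetwork eta) by exists eta.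
  by rewrite -I => -[eta'' /not_self].
by apply: K12; congr homeostasis_subnetwork; apply/val_inj/anti_leq/andP; split; apply: le_of.
Qed.
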